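(* The set of all permutative semigroup varieties is definable.
   Context: $\mathbf{SEM}$ denotes the lattice of all semigroup varieties, ordered by inclusion, with join $\vee$ and meet $\wedge$. A subset $A$ of a lattice $\langle L;\vee,\wedge\rangle$ is called definable in $L$ if there is a first-order formula $\Phi(x)$ with one free variable $x$ (and no parameters) in the language of the lattice operations $\vee$ and $\wedge$ such that, for every $a\in L$, the sentence $\Phi(a)$ is true in $L$ if and only if $a\in A$. A set of semigroup varieties is called definable if it is definable in $\mathbf{SEM}$. An identity of the form $x_1x_2\cdots x_n=x_{1\alpha}x_{2\alpha}\cdots x_{n\alpha}$, where $\alpha$ is a non-trivial permutation of the set $\{1,2,\dots,n\}$ (and $i\alpha$ denotes the image of $i$ under $\alpha$), is called permutational. A semigroup variety is called permutative if it satisfies some permutational identity. *)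

(* Defs.v *)
From HB Require Import structures.
From mathcomp Require Import all_boot all_order all_fingroup.
From mathcomp Require Import boolp classical_sets.

Set Implicit Arguments.
Unset Strict Implicit.
Unset Printing Implicit Defensive.

Import Order.TTheory.

Local Open Scope classical_set_scope.
Local Open Scope group_scope.

(* MathComp's semigroupType cannot be used here: its universe is too large for
   set semigroupType to typecheck, so varieties, being classes of semigroups,
   need a type of semigroups in its own universe. As usual, semigroups are
   non-empty. *)
Record semigroup := MkSemigroup {
  sg_sort :> Type;
  sg_mul : sg_sort -> sg_sort -> sg_sort;
  sg_mulA : associative sg_mul;
  sg_nonempty : inhabited sg_sort
}.

(* A semigroup word is non-empty: it is given by its first letter and the
   sequence of the remaining ones; letters are natural numbers. *)
Definition word := (nat * seq nat)%type.

Definition word_eval (S : semigroup) (phi : nat -> S) (w : word) : S :=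
  foldl (fun s x => sg_mul s (phi x)) (phi w.1) w.2.

Definition identity := (word * word)%type.

Definition satisfies (S : semigroup) (i : identity) : Prop :=
  forall phi : nat -> S, word_eval phi i.1 = word_eval phi i.2.

Definition models (I : set identity) : set semigroup :=
  [set S | forall i, I i -> satisfies S i].

(* Equality of varieties is Leibniz equality of the classes of their members
   (SEM_eqP below), not of sets of defining identities. *)
Record SEM := Variety {
  variety_class : set semigroup;
  variety_equational : exists I : set identity, variety_class = models I
}.

Definition var_satisfies (V : SEM) (i : identity) : Prop :=
  forall S : semigroup, variety_class V S -> satisfies S i.

Section Lattice.
Implicit Types U V W : SEM.

Lemma SEM_eqP V W : variety_class V = variety_class W -> V = W.
Proof.
by case: V W => [V HV] [W HW] /= E; subst W; rewrite (Prop_irrelevance HV HW).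
Qed.

HB.instance Definition _ := gen_eqMixin SEM.
HB.instance Definition _ := gen_choiceMixin SEM.

Definition SEM_le V W : bool := `[< variety_class V `<=` variety_class W >].

Fact SEM_le_refl : reflexive SEM_le.
Proof. by move=> V; apply/asboolP. Qed.

Fact SEM_le_anti : antisymmetric SEM_le.
Proof.
by move=> V W /andP[/asboolP VW /asboolP WV]; apply/SEM_eqP/seteqP; split.
Qed.

Fact SEM_le_trans : transitive SEM_le.
Proof.
move=> W U V /asboolP UW /asboolP WV; apply/asboolP.
exact: subset_trans UW WV.
Qed.

Fact SEM_display : Order.disp_t. Proof. exact: Order.Disp tt tt. Qed.

HB.instance Definition _ := Order.Le_isPOrder.Build SEM_display SEM
  SEM_le_refl SEM_le_anti SEM_le_trans.

Fact SEM_meet_subproof V W :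
  exists I, variety_class V `&` variety_class W = models I.
Proof.
have [[I VI] [J WJ]] := (variety_equational V, variety_equational W).
exists (I `|` J); rewrite VI WJ; apply/seteqP; split=> S /=.
  by move=> [SI SJ] i [/SI|/SJ].
by move=> SIJ; split=> i Hi; apply: SIJ; [left | right].
Qed.

Definition SEM_meet V W : SEM := Variety (SEM_meet_subproof V W).

(* The variety defined by the identities common to V and W, i.e. the least
   variety containing both; the union of the classes need not be a variety. *)
Definition SEM_join V W : SEM :=
  @Variety (models (var_satisfies V `&` var_satisfies W)) (ex_intro _ _ erefl).

Fact SEM_meetP U V W : (U <= SEM_meet V W)%O = (U <= V)%O && (U <= W)%O.
Proof.
apply/asboolP/andP => [UVW | [/asboolP UV /asboolP UW] S US].
  by split; apply/asboolP => S /UVW[].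
by split; [apply: UV | apply: UW].
Qed.

Fact SEM_joinP U V W : (SEM_join U V <= W)%O = (U <= W)%O && (V <= W)%O.
Proof.
apply/asboolP/andP => [UVW | [/asboolP UW /asboolP VW] S US].
  by split; apply/asboolP => S HS; apply: UVW => i [Ui Vi];
     [apply: Ui | apply: Vi].
have [I WI] := variety_equational W; rewrite WI => i Ii; apply: US.
split=> T; [move/UW | move/VW]; rewrite WI; exact.
Qed.

HB.instance Definition _ := Order.POrder_MeetJoin_isLattice.Build
  SEM_display SEM SEM_meetP SEM_joinP.

End Lattice.

(* x_1 ... x_(n+1) = x_(1a) ... x_((n+1)a), the variable x_k being the letter
   k - 1; the first letter of each word is listed apart, as required by word. *)
Definition perm_identity n (a : 'S_n.+1) : identity :=
  ((0, [seq val (lift ord0 i) | i : 'I_n]),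
   (val (a ord0), [seq val (a (lift ord0 i)) | i : 'I_n])).

Definition permutational (i : identity) : Prop :=
  exists n (a : 'S_n.+1), a != 1 /\ i = perm_identity a.

Definition permutative (V : SEM) : Prop :=
  exists2 i, permutational i & var_satisfies V i.

(* First-order formulas in the language of lattices, whose free variables are
   indexed by 'I_n; in LForall f and LExists f the variable ord0 of f is the
   bound one, and lift ord0 i is the variable i outside the quantifier. *)
Inductive lterm (n : nat) : Type :=
| LVar of 'I_n
| LMeet of lterm n & lterm n
| LJoin of lterm n & lterm n.

Inductive lformula : nat -> Type :=
| LEq n of lterm n & lterm n : lformula n
| LNot n of lformula n : lformula n
| LAnd n of lformula n & lformula n : lformula n
| LOr n of lformula n & lformula n : lformula n
| LImp n of lformula n & lformula n : lformula n
| LForall n of lformula n.+1 : lformula n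
| LExists n of lformula n.+1 : lformula n.

Section Semantics.
Context {d : Order.disp_t} (L : latticeType d).

Definition scons n (x : L) (e : 'I_n -> L) (i : 'I_n.+1) : L :=
  if unlift ord0 i is Some j then e j else x.

Fixpoint leval n (e : 'I_n -> L) (t : lterm n) : L :=
  match t with
  | LVar i => e i
  | LMeet t1 t2 => Order.meet (leval e t1) (leval e t2)
  | LJoin t1 t2 => Order.join (leval e t1) (leval e t2)
  end.

Fixpoint holds n (f : lformula n) : ('I_n -> L) -> Prop :=
  match f with
  | LEq _ t1 t2 => fun e => leval e t1 = leval e t2
  | LNot _ g => fun e => ~ holds g e
  | LAnd _ g h => fun e => holds g e /\ holds h e
  | LOr _ g h => fun e => holds g e \/ holds h e
  | LImp _ g h => fun e => holds g e -> holds h e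
  | LForall _ g => fun e => forall x, holds g (scons x e)
  | LExists _ g => fun e => exists x, holds g (scons x e)
  end.

Definition definable (A : set L) : Prop :=
  exists Phi : lformula 1, forall a : L, holds Phi (fun=> a) <-> A a.

End Semantics.

(* Main.v *)
Require Import Defs.
From mathcomp Require Import all_boot all_order all_fingroup.
From mathcomp Require Import boolp classical_sets.
From mathcomp Require Import zify.
From Stdlib Require Import RelationClasses Morphisms Setoid.
From Stdlib Require Import Relation_Operators Operators_Properties.

Set Implicit Arguments.
Unset Strict Implicit.
Unset Printing Implicit Defensive.

Import Order.TTheory.

Local Open Scope classical_set_scope.

(** A variety V is studied through the fully invariant congruence [eqn V] of
    its identities; a smaller variety has more identities, and every fully
    invariant congruence is the [eqn] of a variety ([eqn_presented]).

    Two varieties guide the proof. In [linear_nil], called N here, all the words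
    with a repeated letter are identified (they become a zero), and no other
    words are. Its commutative part C is [comm_linear_nil]. Let A be the join of
    all the atoms of SEM. An atom is the variety of null semigroups, of
    semilattices, of left or right zero semigroups, or of abelian groups of
    prime exponent, whence two properties of A: it satisfies x y z t = x z y t,
    and its identities are balanced, as they count letters modulo every prime.

    If V is not permutative, then N <= V \/ A: an identity of V \/ A that fails
    in N has a linear side, and being balanced it permutes the letters of that
    side. If V is permutative, say V satisfies p = q with p linear and q another
    arrangement of its letters, then V \/ A satisfies the permutational
    identity y p z = y q z, so N is not below V \/ A. This would prove the
    theorem if N were definable. In its place we take any variety B that is
    lower-modular in SEM and is not too small; the latter means that B and A
    have a common subvariety D which is not the bottom and has no lower cover.
    All of this is first-order, and N is such a B, with D = C: the congruence of
    N is a Rees congruence, which makes it lower-modular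
    ([linear_nil_lower_modular]), and the proper subvarieties of C are the
    members of an infinite chain ([comm_linear_nil_no_lower_cover]).

    It remains to see that a permutative V has no such B and D with
    B <= V \/ A. As B satisfies a permutational identity, lower modularity,
    tested on one well-chosen pair of varieties, forces an identity
    x_1 ... x_n = x_1 ... x_n s with s non-empty on B
    ([lower_modular_absorption]), hence on D. Since D <= A, the letters inside
    a word also commute in D. Then, in a long enough word, only the first
    letter, the last letter, the set of the inner letters and their
    multiplicities modulo some r matter ([eqn_counts]). From this it follows
    that finitely many identities suffice to separate all the proper
    subvarieties of D from D, so that D does have a lower cover
    ([finite_identities_lower_cover]). *)

(** * Words, substitutions and the congruence of identities *)

Definition subst (f : nat -> seq nat) (s : seq nat) := flatten [seq f x | x <- s].

Lemma subst_cons f x s : subst f (x :: s) = f x ++ subst f s.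
Proof. by []. Qed.

Lemma subst_cat f s t : subst f (s ++ t) = subst f s ++ subst f t.
Proof. by rewrite /subst map_cat flatten_cat. Qed.

Lemma subst_nseq f k x : subst f (nseq k x) = flatten (nseq k (f x)).
Proof. by elim: k => //= k IH; rewrite subst_cons IH. Qed.

Lemma subst_comp f g s : subst f (subst g s) = subst (fun x => subst f (g x)) s.
Proof. by elim: s => //= x s IH; rewrite !subst_cons subst_cat IH. Qed.

Lemma eq_in_subst f g s : {in s, f =1 g} -> subst f s = subst g s.
Proof. by move=> fg; rewrite /subst; congr flatten; apply/eq_in_map. Qed.

Lemma subst_map f s : subst (fun x => [:: f x]) s = map f s.
Proof. by elim: s => //= x s <-. Qed.

Lemma size_subst f s : (forall x, f x != [::]) -> size s <= size (subst f s).
Proof.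
move=> f0; elim: s => //= x s IH; rewrite subst_cons size_cat.
by case: (f x) (f0 x) => //= y r _; lia.
Qed.

Lemma subst_eq0 f s : (forall x, f x != [::]) -> (subst f s == [::]) = (s == [::]).
Proof.
by move=> f0; case: s => //= x s; rewrite subst_cons; case: (f x) (f0 x).
Qed.

(** Congruences are taken on the free monoid, so that words can be
    concatenated freely; the last clause isolates the empty word, which stands
    for no element of a semigroup. *)
Record fully_invariant (R : seq nat -> seq nat -> Prop) : Prop := {
  fi_equiv : Equivalence R;
  fi_cat : forall s s' t t', R s s' -> R t t' -> R (s ++ t) (s' ++ t');
  fi_subst : forall f s t, (forall x, f x != [::]) -> R s t ->
    R (subst f s) (subst f t);
  fi_nil : forall s, R [::] s -> s = [::] }.

Section Evaluation.
Variable S : semigroup.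
Implicit Types (phi : nat -> S) (a b : option S).

(** The monoid obtained from S by adjoining a unit, to give a value to the empty
    word. *)
Definition omul a b : option S :=
  match a, b with
  | Some x, Some y => Some (sg_mul x y)
  | Some x, None => Some x
  | None, _ => b
  end.

Definition seval phi (s : seq nat) : option S :=
  if s is x :: s' then Some (word_eval phi (x, s')) else None.

Lemma omulA : associative omul.
Proof. by move=> [a|] [b|] [c|] //=; rewrite sg_mulA. Qed.

Lemma seval_foldr phi s : seval phi s = foldr (fun x => omul (Some (phi x))) None s.
Proof.
case: s => //= x s; rewrite /word_eval /=.
elim: s (phi x) => //= y s IH a; rewrite IH /=.
by case: (foldr _ _ _) => [b|] //=; rewrite sg_mulA.
Qed.

Lemma seval_cat phi s t : seval phi (s ++ t) = omul (seval phi s) (seval phi t).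
Proof.
rewrite !seval_foldr; elim: s => // x s IH.
have foldE r : foldr (fun y => omul (Some (phi y))) None (x :: r) =
  omul (Some (phi x)) (foldr (fun y => omul (Some (phi y))) None r) by [].
by rewrite cat_cons !foldE IH omulA.
Qed.

Lemma seval_cons phi x s :
  seval phi (x :: s) = omul (Some (phi x)) (seval phi s).
Proof. by rewrite -cat1s seval_cat. Qed.

Lemma seval_subst phi psi f s : (forall x, seval phi (f x) = Some (psi x)) ->
  seval phi (subst f s) = seval psi s.
Proof.
move=> fE; elim: s => // x s IH.
by rewrite subst_cons seval_cat seval_cons fE IH.
Qed.

End Evaluation.

Definition eqn (V : SEM) (s t : seq nat) : Prop :=
  (s == [::]) = (t == [::]) /\
  forall S, variety_class V S -> forall phi : nat -> S, seval phi s = seval phi t.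

Lemma eqnE V (i : identity) :
  eqn V (i.1.1 :: i.1.2) (i.2.1 :: i.2.2) <-> var_satisfies V i.
Proof.
case: i => [[x s] [y t]] /=; split => [[_ E] S VS phi|E].
  by have /= := E _ VS phi => -[].
by split=> // S VS phi /=; congr Some; apply: (E S VS phi).
Qed.

Lemma eqn_fully_invariant V : fully_invariant (eqn V).
Proof.
split.
- split=> [s|s t [e E]|s t u [e E] [e' E']]; split=> //.
  + by move=> S VS phi; rewrite E.
  + by rewrite e.
  + by move=> S VS phi; rewrite E // E'.
- move=> s s' t t' [e E] [e' E']; split.
    by rewrite -!size_eq0 !size_cat !addn_eq0 !size_eq0 e e'.
  by move=> S VS phi; rewrite !seval_cat E // E'.
- move=> f s t f0 [e E]; split; first by rewrite !subst_eq0.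
  move=> S VS phi.
  have fE x : seval phi (f x) = Some (word_eval phi (head 0 (f x), behead (f x))).
    by case: (f x) (f0 x).
  by rewrite !(seval_subst _ fE) E.
- by move=> s [+ _]; rewrite eqxx => /esym/eqP.
Qed.

#[export] Instance eqn_equivalence V : Equivalence (eqn V) :=
  fi_equiv (eqn_fully_invariant V).

#[export] Instance eqn_cat V : Proper (eqn V ==> eqn V ==> eqn V) cat.
Proof. by move=> s s' ss' t t' tt'; apply: (fi_cat (eqn_fully_invariant V)). Qed.

Lemma eqn_subst V f s t : (forall x, f x != [::]) ->
  eqn V s t -> eqn V (subst f s) (subst f t).
Proof. exact: (fi_subst (eqn_fully_invariant V)). Qed.

(** The order of varieties is the reverse of the inclusion of congruences: a
    variety is recovered from its identities. *)
Lemma SEM_leP V W :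
  (V <= W)%O <-> (forall s t, eqn W s t -> eqn V s t).
Proof.
split=> [/asboolP VW s t [e E]|VW]; first by split=> // S /VW; apply: E.
apply/asboolP => S VS; have [J WJ] := variety_equational W; rewrite WJ => i Ji.
have /eqnE/VW/eqnE : var_satisfies W i by move=> T; rewrite WJ; apply.
exact.
Qed.

Lemma eqn_anti V W s t : (V <= W)%O -> eqn W s t -> eqn V s t.
Proof. by move=> /SEM_leP; apply. Qed.

Section Presentation.
Variables (R : seq nat -> seq nat -> Prop).

Definition presented : SEM :=
  @Variety (models [set i | R (i.1.1 :: i.1.2) (i.2.1 :: i.2.2)])
    (ex_intro _ _ erefl).

Hypothesis RP : fully_invariant R.
#[local] Instance pres_equiv : Equivalence R := fi_equiv RP.

Let rep (s : seq nat) : seq nat := xget [::] (R s).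

Let repP s : R s (rep s).
Proof. by rewrite /rep; case: xgetP => [t _ //|/(_ s) []]; reflexivity. Qed.

Let rep_eq s t : R s t -> rep s = rep t.
Proof.
move=> st; rewrite /rep; congr xget; apply/funext => u; apply/propext.
by split=> [su|tu]; [symmetry in st|]; etransitivity; eauto.
Qed.

Let repK s : rep (rep s) = rep s.
Proof. by apply: rep_eq; symmetry. Qed.

Let rep0 s : (rep s == [::]) = (s == [::]).
Proof.
apply/eqP/eqP => [E|->]; last exact: (fi_nil RP (repP _)).
by apply: (fi_nil RP); symmetry; rewrite -E.
Qed.

Let reduced (s : seq nat) := (s != [::]) && (rep s == s).

Let carrier := {s : seq nat | reduced s}.

Let in_carrier s : s != [::] -> reduced (rep s).
Proof. by move=> s0; rewrite /reduced rep0 s0 repK /=. Qed.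

Let fmul_proof (a b : carrier) : val a ++ val b != [::].
Proof. by case: a => [[|x s] /= Hs]. Qed.

Let fmul (a b : carrier) : carrier := exist reduced _ (in_carrier (fmul_proof a b)).

Let fmulA : associative fmul.
Proof.
move=> a b c; apply: val_inj => /=; apply: rep_eq.
transitivity (val a ++ val b ++ val c).
  by apply: (fi_cat RP); [reflexivity | symmetry].
by rewrite catA; apply: (fi_cat RP); [|reflexivity].
Qed.

Let gen (x : nat) : carrier := exist reduced _ (in_carrier (isT : [:: x] != [::])).

Let free : semigroup := MkSemigroup fmulA (inhabits (gen 0)).

Let seval_free (phi : nat -> free) s : s != [::] ->
  seval phi s = insub (rep (subst (fun x => val (phi x)) s)).
Proof.
elim: s => // x s IH _; rewrite seval_cons.
have -> : subst (fun x => val (phi x)) (x :: s) =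
  val (phi x) ++ subst (fun x => val (phi x)) s by [].
have [->/=|s0] := eqVneq s [::].
  rewrite cats0; case: (phi x) => /= t Ht; rewrite insubT.
    by case/andP: (Ht) => _ /eqP ->.
  move=> p; congr Some; apply: val_inj => /=.
  by case/andP: (Ht) => _ /eqP ->.
rewrite IH // insubT.
  by apply: in_carrier; rewrite subst_eq0 // => y; case: (phi y) => t /= /andP[].
move=> p /=; rewrite insubT; first by apply: in_carrier; case: (phi x) => -[].
move=> q; congr Some; apply: val_inj => /=; apply: rep_eq.
by apply: (fi_cat RP); [reflexivity | symmetry].
Qed.

(** Completeness of equational reasoning. The words modulo R, represented by
    normal forms [rep s], make up a semigroup [free]. It satisfies the
    identities in R because R is stable under substitution, and evaluating at
    the letters themselves shows that it satisfies no others. *)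
Lemma eqn_presented s t : eqn presented s t <-> R s t.
Proof.
split.
  case: s t => [|x s] [|y t] E; [reflexivity | by case: E | by case: E |].
  have freeP : variety_class presented free.
    move=> /= [[a u] [b v]] /= Ruv phi.
    have : seval phi (a :: u) = seval phi (b :: v).
      rewrite !seval_free //; congr insub; apply: rep_eq; apply: (fi_subst RP) => // z.
      by case: (phi z) => w /= /andP[].
    by move=> [].
  case: E => _ /(_ _ freeP gen).
  have lem w : w != [::] -> rep (subst (fun x => rep [:: x]) w) = rep w.
    move=> w0; apply: rep_eq; symmetry; elim: w {w0} => [|z w IH]; first by reflexivity.
    by rewrite subst_cons -cat1s; apply: (fi_cat RP).
  rewrite !seval_free // !insubT.
  - by apply: in_carrier; rewrite subst_eq0 // => z; rewrite rep0.
  - by apply: in_carrier; rewrite subst_eq0 // => z; rewrite rep0.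
  move=> p q [/= E]; rewrite !lem // in E.
  by etransitivity; first exact: repP; rewrite E; symmetry.
move=> Rst; split.
  apply/eqP/eqP => E; rewrite E in Rst; first exact: (fi_nil RP Rst).
  by apply: (fi_nil RP); symmetry.
case: s t Rst => [|x s] [|y t] Rst S PS phi //.
- by have := fi_nil RP Rst.
- by symmetry in Rst; have := fi_nil RP Rst.
by rewrite /=; congr Some; apply: (PS ((x, s), (y, t)) Rst).
Qed.

End Presentation.

(** * Lower-modular varieties and lower covers *)

Lemma eqn_join V W s t : eqn (Order.join V W) s t <-> eqn V s t /\ eqn W s t.
Proof.
split=> [E|[[e E] [_ E']]].
  by split; apply: eqn_anti E; [apply: leUl | apply: leUr].
case: s t e E E' => [|x s] [|y t] // e E E'.
apply/(@eqnE _ ((x, s), (y, t))) => S; apply; split => T TV phi.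
  by have := E _ TV phi => -[].
by have := E' _ TV phi => -[].
Qed.

Section MeetEquations.
Variables V W : SEM.
Let step s t := eqn V s t \/ eqn W s t.

Let stepC s t : step s t -> step t s.
Proof. by case=> E; [left | right]; symmetry. Qed.

Lemma meet_steps_fully_invariant : fully_invariant (clos_refl_trans _ step).
Proof.
split.
- split=> [s|s t|s t u]; first exact: rt_refl.
    elim=> [a b /stepC|a|a b c _ ba _ cb]; [exact: rt_step | exact: rt_refl |].
    exact: rt_trans cb ba.
  exact: rt_trans.
- move=> s s' t t' ss' tt'; apply: (@rt_trans _ _ _ (s' ++ t)).
    elim: ss' => {s s'} [a b|a|a b c _ ba _ cb]; last exact: rt_trans ba cb.
    + by case=> E; apply: rt_step; [left | right]; rewrite E; reflexivity.
    + exact: rt_refl.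
  elim: tt' => {t t'} [a b|a|a b c _ ba _ cb]; last exact: rt_trans ba cb.
  + by case=> E; apply: rt_step; [left | right]; rewrite E; reflexivity.
  + exact: rt_refl.
- move=> f s t f0; elim=> [a b|a|a b c _ ba _ cb]; last exact: rt_trans ba cb.
  + by case=> E; apply: rt_step; [left | right]; apply: eqn_subst.
  + exact: rt_refl.
- move=> s H; have {}H := clos_rt_rtn1 _ _ _ _ H.
  elim: H => // t u [] tu _ e; subst t.
    exact: (fi_nil (eqn_fully_invariant V)).
  exact: (fi_nil (eqn_fully_invariant W)).
Qed.

(** The steps that use an identity of V or one of W generate a fully invariant
    congruence, so a common consequence is reached by a chain of such steps. *)
Lemma eqn_meet s t :
  eqn (Order.meet V W) s t <-> clos_refl_trans _ (fun a b => eqn V a b \/ eqn W a b) s t.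
Proof.
split=> [|st].
  move: s t; have P := eqn_presented meet_steps_fully_invariant.
  suff /SEM_leP H : (presented (clos_refl_trans _ step) <= Order.meet V W)%O.
    by move=> s t /H/P.
  rewrite lexI; apply/andP; split; apply/SEM_leP => s t E; apply/P; apply: rt_step.
    by left.
  by right.
elim: st => [a b [|]|a|a b c _ ab _ bc].
- by apply: eqn_anti; apply: leIl.
- by apply: eqn_anti; apply: leIr.
- by reflexivity.
by rewrite ab.
Qed.

End MeetEquations.

Definition lower_modular (B : SEM) : Prop := forall Y Z : SEM, (B <= Y)%O ->
  (Order.meet Y (Order.join B Z) <= Order.join B (Order.meet Y Z))%O.

Definition no_lower_cover (D : SEM) : Prop :=
  (exists W, (W < D)%O) /\ forall W, (W < D)%O -> exists U, (W < U)%O /\ (U < D)%O.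

(** Otherwise start from some W < D. An upper bound X < D in the list lies below
    some U with X < U < D, and X bounds nothing above U. Hence each step discards
    an entry of the list, until none is left. *)
Lemma finitely_dominated_lower_cover (D : SEM) (l : seq SEM) :
  (forall W, (W < D)%O -> exists X, [/\ X \in l, (W <= X)%O & (X < D)%O]) ->
  ~ no_lower_cover D.
Proof.
move=> H [[W0 W0D] cov].
have {H} : forall W, (W0 <= W)%O -> (W < D)%O ->
  exists X, [/\ X \in l, (W <= X)%O & (X < D)%O] by move=> W _; apply: H.
elim: l W0 W0D => [|X l IH] W0 W0D H; first by have [X []] := H _ (lexx _) W0D.
have [XD|XD] := pselect ((W0 <= X)%O /\ (X < D)%O).
  have [U [XU UD]] := cov _ XD.2.
  apply: (IH U UD) => W UW WD.
  have [Y [+ WY YD]] := H W (le_trans XD.1 (le_trans (ltW XU) UW)) WD.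
  rewrite in_cons => /orP[/eqP E|Yl]; last by exists Y.
  by have := lt_le_trans XU (le_trans UW WY); rewrite E ltxx.
apply: (IH W0 W0D) => W W0W WD; have [Y [+ WY YD]] := H W W0W WD.
rewrite in_cons => /orP[/eqP E|Yl]; last by exists Y.
by case: XD; rewrite -E; split=> //; apply: le_trans WY.
Qed.

Lemma SEM_ltP (V W : SEM) : (V < W)%O <->
  (V <= W)%O /\ exists s t, eqn V s t /\ ~ eqn W s t.
Proof.
rewrite lt_leAnge; split=> [/andP[-> /negP H]|[-> [s [t [Vst Wst]]]] /=].
  split=> //; apply: contrapT => N; apply: H; apply/SEM_leP => s t Vst.
  by apply: contrapT => Wst; apply: N; exists s, t.
by apply/negP => /SEM_leP/(_ _ _ Vst).
Qed.

Lemma not_SEM_le (V W : SEM) : ~ (V <= W)%O <-> exists s t, eqn W s t /\ ~ eqn V s t.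
Proof.
split=> [N|[s [t [Ws Vs]]] /SEM_leP/(_ _ _ Ws)//].
apply: contrapT => N'; apply: N; apply/SEM_leP => s t Ws.
by apply: contrapT => Vs; apply: N'; exists s, t.
Qed.

(** * The variety of linear words and its commutative part *)

Lemma uniq_subst f s : (forall x, f x != [::]) -> uniq (subst f s) -> uniq s.
Proof.
move=> f0; elim: s => //= x s IH; rewrite subst_cons cat_uniq => /and3P[_ N /IH->].
rewrite andbT; apply: contra N => xs; apply/hasP.
case E: (f x) (f0 x) => [//|y r] _; exists y; last by rewrite mem_head.
by apply/flattenP; exists (f x); [apply: map_f | rewrite E mem_head].
Qed.

Definition nonlinear_zero (s t : seq nat) : Prop :=
  s = t \/ ~~ uniq s /\ ~~ uniq t.

Definition nonlinear_zero_comm (s t : seq nat) : Prop :=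
  perm_eq s t \/ ~~ uniq s /\ ~~ uniq t.

(** As n varies, these congruences define the proper subvarieties of the
    commutative part of the variety of linear words. *)
Definition long_nonlinear_zero_comm n (s t : seq nat) : Prop :=
  perm_eq s t \/
  (~~ uniq s || (n <= size s)) /\ (~~ uniq t || (n <= size t)).

Lemma nonlinear_zero_fully_invariant : fully_invariant nonlinear_zero.
Proof.
split.
- split=> [s|s t [->|[]]|s t u [->|[st ts]]//]; [by left | by left | by right |].
  by case=> [<-|[]]; right.
- move=> s s' t t' [->|[ss s's]] [->|[tt t't]]; first by left.
  + by right; rewrite !cat_uniq (negPf tt) (negPf t't) !andbF.
  + by right; rewrite !cat_uniq (negPf ss) (negPf s's).
  + by right; rewrite !cat_uniq (negPf ss) (negPf s's).
- move=> f s t f0 [->|[st ts]]; [by left | right].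
  by split; [apply: contra st | apply: contra ts]; apply: uniq_subst.
- by move=> s [|[]].
Qed.

Lemma perm_subst f s t : perm_eq s t -> perm_eq (subst f s) (subst f t).
Proof. by move=> st; apply: perm_flatten; apply: perm_map. Qed.

Lemma long_nonlinear_zero_comm_fully_invariant n : 0 < n ->
  fully_invariant (long_nonlinear_zero_comm n).
Proof.
move=> n0.
have bad (s t : seq nat) : perm_eq s t ->
    (~~ uniq s || (n <= size s)) = (~~ uniq t || (n <= size t)).
  by move=> st; rewrite (perm_uniq st) (perm_size st).
have badl (s t : seq nat) : ~~ uniq s || (n <= size s) ->
    ~~ uniq (s ++ t) || (n <= size (s ++ t)).
  rewrite cat_uniq size_cat => /orP[/negPf->//|ns]; apply/orP; right; lia.
have badr (s t : seq nat) : ~~ uniq s || (n <= size s) ->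
    ~~ uniq (t ++ s) || (n <= size (t ++ s)).
  by move=> H; rewrite -(bad _ _ (permEl (perm_catC s t))); apply: badl.
split.
- split=> [s|s t [|[]]|s t u [st|[st ts]] [tu|[tu ut]]]; rewrite /long_nonlinear_zero_comm.
  + by left.
  + by rewrite perm_sym; left.
  + by right.
  + by left; apply: perm_trans tu.
  + by right; rewrite (bad _ _ st).
  + by right; rewrite -(bad _ _ tu).
  + by right.
- move=> s s' t t' [ss|[ss s's]] [tt|[tt t't]].
  + by left; apply: perm_cat.
  + by right; split; apply: badr.
  + by right; split; apply: badl.
  + by right; split; apply: badl.
- move=> f s t f0 [st|[st ts]]; [by left; apply: perm_subst | right].
  suff H w : ~~ uniq w || (n <= size w) ->
      ~~ uniq (subst f w) || (n <= size (subst f w)).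
    by split; apply: H.
  move=> /orP[wu|wn]; apply/orP; [left | right].
    by apply: contra wu; apply: uniq_subst.
  exact: leq_trans wn (size_subst _ f0).
- move=> s [|[]]; first by rewrite perm_sym => /perm_nilP.
  by rewrite /= leqn0 => /eqP n0'; move: n0; rewrite n0'.
Qed.

(** On words shorter than n the relation agrees with its n-th approximation,
    and each closure condition involves boundedly long words. *)
Lemma nonlinear_zero_comm_fully_invariant : fully_invariant nonlinear_zero_comm.
Proof.
have F n := long_nonlinear_zero_comm_fully_invariant (ltn0Sn n).
have up n s t : nonlinear_zero_comm s t -> long_nonlinear_zero_comm n s t.
  by case=> [|[st ts]]; [left | right; rewrite st ts].
have down n s t : size s < n -> size t < n -> long_nonlinear_zero_comm n s t ->
    nonlinear_zero_comm s t.
  move=> sn tn [|[]]; [by left|]; rewrite leqNgt sn leqNgt tn !orbF.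
  by right.
split.
- split=> [s|s t|s t u st tu].
  + by left.
  + by case=> [|[]]; [rewrite perm_sym; left | right].
  + pose n := (size s + size t + size u).+1.
    apply: (down n); rewrite /n; [lia|lia|].
    have [_ _ tr] := fi_equiv (F (size s + size t + size u)).
    by apply: tr (up _ _ _ st) (up _ _ _ tu).
- move=> s s' t t' ss tt.
  pose n := size (s ++ t) + size (s' ++ t').
  by apply: (down n.+1); rewrite /n; [lia|lia|]; apply: (fi_cat (F n)); apply: up.
- move=> f s t f0 st; pose n := size (subst f s) + size (subst f t).
  by apply: (down n.+1); rewrite /n; [lia|lia|]; apply: (fi_subst (F n)); last apply: up.
- by move=> s [|[]//]; rewrite perm_sym => /perm_nilP.
Qed.

Definition linear_nil := presented nonlinear_zero.
Definition comm_linear_nil := presented nonlinear_zero_comm.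

Lemma eqn_linear_nil s t : eqn linear_nil s t <-> nonlinear_zero s t.
Proof. exact: eqn_presented nonlinear_zero_fully_invariant s t. Qed.

Lemma eqn_comm_linear_nil s t : eqn comm_linear_nil s t <-> nonlinear_zero_comm s t.
Proof. exact: eqn_presented nonlinear_zero_comm_fully_invariant s t. Qed.

Lemma comm_linear_nil_le : (comm_linear_nil <= linear_nil)%O.
Proof.
apply/SEM_leP => s t /eqn_linear_nil st; apply/eqn_comm_linear_nil.
by case: st => [->|]; [left | right].
Qed.

(** Let u and v be zero in N, and let a chain of identities of Y and Z lead from
    u to v. The identities of Y do not touch a linear word, because N <= Y.
    Hence a stretch of the chain through linear words only uses Z, and it joins
    two zeros of N: it is an identity of N \/ Z. The invariant [w] of the
    induction is the last zero met before such a stretch. *)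
Lemma linear_nil_lower_modular : lower_modular linear_nil.
Proof.
move=> Y Z NY; apply/SEM_leP => u v /eqn_join[Nuv]; rewrite !eqn_meet => uv.
have YN := proj1 (SEM_leP _ _) NY.
case/eqn_linear_nil: (Nuv) => [->|[u0 v0]]; first exact: rt_refl.
have Nn a b : ~~ uniq a -> ~~ uniq b -> eqn linear_nil a b.
  by move=> *; apply/eqn_linear_nil; right.
pose chain := clos_refl_trans _ (fun a b => eqn Y a b \/ eqn (Order.join linear_nil Z) a b).
have [w [w0 uw wv]] : exists w, [/\ ~~ uniq w, chain u w & eqn Z w v].
  have := clos_rt_rtn1 _ _ _ _ uv; elim=> [|b c bc _ [w [w0 uw wb]]].
    by exists u; split=> //; apply: rt_refl.
  case: bc => bc; last by exists w; split=> //; rewrite wb.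
  have [E|[b0 c0]] := proj1 (eqn_linear_nil _ _) (YN _ _ bc); first by exists w; rewrite -E.
  exists c; split=> //.
  apply: (rt_trans _ _ _ w) => //; apply: (rt_trans _ _ _ b); last by apply: rt_step; left.
  by apply: rt_step; right; apply/eqn_join; split=> //; apply: Nn.
apply: (rt_trans _ _ _ w) => //; apply: rt_step; right.
by apply/eqn_join; split=> //; apply: Nn.
Qed.

(** A word that is at least as long as a linear word p is a substitution
    instance of p: give one letter to each letter of p but the last. *)
Lemma subst_onto (p w : seq nat) : uniq p -> p != [::] -> size p <= size w ->
  exists g, (forall x, g x != [::]) /\ subst g p = w.
Proof.
elim: p w => // x [|y r] IH [|a w] // pu _ pw.
  by exists (fun=> a :: w); rewrite /subst /= cats0.
have /andP[xr yr] := pu; have [g [g0 gE]] := IH w yr isT pw.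
exists (fun z => if z == x then [:: a] else g z); split=> [z|].
  by case: ifP.
rewrite subst_cons eqxx (@eq_in_subst _ g) ?gE // => z zr.
by case: eqP => // E; rewrite -E zr in xr.
Qed.

(** A proper subvariety W of C satisfies p = 0 for some linear word p: an
    identity that fails in C either equates a linear word to a zero, or it
    relates linear words with different letters, and then doubling a letter
    that occurs in one side only makes that side zero. So in W all words of
    length at least [size p] are zero, and W lies strictly below the subvariety
    of C where only the words of length above [size p] are. *)
Lemma comm_linear_nil_no_lower_cover : no_lower_cover comm_linear_nil.
Proof.
pose Cn n := presented (long_nonlinear_zero_comm n.+1).
have eqn_Cn n s t : eqn (Cn n) s t <-> long_nonlinear_zero_comm n.+1 s t.
  exact: eqn_presented (long_nonlinear_zero_comm_fully_invariant (ltn0Sn n)) s t.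
have CnC n : (Cn n < comm_linear_nil)%O.
  apply/SEM_ltP; split.
    apply/SEM_leP => s t /eqn_comm_linear_nil st; apply/eqn_Cn.
    by case: st => [|[st ts]]; [left | right; rewrite st ts].
  exists (iota 0 n.+1), [:: 0; 0]; split.
    by apply/eqn_Cn; right; rewrite size_iota leqnn orbT.
  move/eqn_comm_linear_nil => [/perm_uniq|[]]; rewrite iota_uniq //.
split; first by exists (Cn 0).
move=> W /SEM_ltP[/SEM_leP CW [u [v [Wuv Cuv]]]].
pose zero := [:: 0; 0].
have W0 w : ~~ uniq w -> eqn W w zero.
  by move=> w0; apply: CW; apply/eqn_comm_linear_nil; right.
(* p is a linear word that vanishes in W. *)
have [p [p_uniq p0 Wp]] : exists p, [/\ uniq p, p != [::] & eqn W p zero].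
  wlog uu : u v Wuv Cuv / uniq u.
    move=> H; have [uu|uu] := boolP (uniq u); first exact: (H u v).
    have [vu|vu] := boolP (uniq v).
      apply: (H v u) => //; first by symmetry.
      move=> /eqn_comm_linear_nil vCu; apply: Cuv; apply/eqn_comm_linear_nil.
      by case: vCu => [|[]]; [rewrite perm_sym; left | right].
    by case: Cuv; apply/eqn_comm_linear_nil; right.
  have u0 : u != [::].
    apply/eqP => E; move: Wuv; rewrite E => /(fi_nil (eqn_fully_invariant W)) vE.
    by case: Cuv; rewrite E vE; reflexivity.
  exists u; split=> //.
  have [vu|vu] := boolP (uniq v); last by rewrite Wuv; apply: W0.
  have dup x a b : uniq a -> x \in a -> x \notin b -> uniq b -> eqn W a b -> eqn W b zero.
    move=> au xa xb bu Wab.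
    pose f z := if z == x then [:: x; x] else [:: z].
    have f0 z : f z != [::] by rewrite /f; case: ifP.
    have fb : subst f b = b.
      rewrite -[RHS]map_id -subst_map; apply: eq_in_subst => z zb; rewrite /f.
      by case: eqP => // E; rewrite E (negPf xb) in zb.
    have fa : ~~ uniq (subst f a).
      elim: (a) xa => //= y r IH; rewrite in_cons subst_cons cat_uniq.
      move=> /orP[/eqP<-|xr]; last by rewrite (negPf (IH xr)) !andbF.
      by rewrite /f eqxx /= in_cons eqxx.
    by rewrite -fb -(eqn_subst f0 Wab); apply: W0.
  have : ~~ perm_eq u v by apply: contra_notN Cuv => H; apply/eqn_comm_linear_nil; left.
  have [/allP sub|/allPn[x xu xv]] := boolP (all (mem v) u); last first.
    by move=> _; rewrite Wuv; apply: (dup x u v).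
  have [/allP sub'|/allPn[x xv xu]] := boolP (all (mem u) v); last first.
    by move=> _; apply: (dup x v u) => //; symmetry.
  by rewrite uniq_perm // => x; apply/idP/idP; [apply: sub | apply: sub'].
(* Every word as long as p is an instance of p. *)
have Wlong w : size p <= size w -> eqn W w zero.
  move=> pw; have [g [g0 <-]] := subst_onto p_uniq p0 pw.
  by rewrite (eqn_subst g0 Wp); apply: W0; apply/negP => /(uniq_subst g0).
exists (Cn (size p)); split=> //; apply/SEM_ltP; split.
  apply/SEM_leP => s t /eqn_Cn [st|[]]; first by apply: CW; apply/eqn_comm_linear_nil; left.
  have bad w : ~~ uniq w || (size p < size w) -> eqn W w zero.
    by move=> /orP[/W0//|pw]; apply: Wlong; apply: ltnW.
  by move=> /bad -> /bad ->; reflexivity.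
exists p, zero; split=> // /eqn_Cn[/perm_uniq|[]]; rewrite p_uniq //.
by rewrite ltnn.
Qed.

Lemma fully_invariant_and (R Q : seq nat -> seq nat -> Prop) :
  fully_invariant R -> fully_invariant Q ->
  fully_invariant (fun s t => R s t /\ Q s t).
Proof.
move=> [[re sy tr] ct sb nl] [[re' sy' tr'] ct' sb' _]; split.
- split=> [s|s t []|s t u [st st'] [tu tu']]; first by split.
    by move=> /sy ? /sy' ?.
  by split; [apply: tr tu | apply: tr' tu'].
- by move=> s s' t t' [? ?] [? ?]; split; [apply: ct | apply: ct'].
- by move=> f s t f0 [? ?]; split; [apply: sb | apply: sb'].
- by move=> s [/nl].
Qed.

Definition long_identified n (s t : seq nat) : Prop :=
  s = t \/ n < size s /\ n < size t.

Lemma long_identified_fully_invariant n : fully_invariant (long_identified n).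
Proof.
split.
- split=> [s|s t [->|[]]|s t u [->//|[ns nt]] [<-|[_ nu]]]; by [left|right].
- move=> s s' t t' [->|[ns ns']] [->|[nt nt']]; [by left|..]; right;
    rewrite !size_cat; lia.
- move=> f s t f0 [->|[ns nt]]; [by left|right].
  by rewrite !(leq_trans _ (size_subst _ f0)).
- by move=> s [|[]].
Qed.

(** The identities of the variety defined by
    x_1 ... x_n = x_1 ... x_n x_(n+1). *)
Definition same_prefix n (s t : seq nat) : Prop :=
  s = t \/ [/\ n <= size s, n <= size t & take n s = take n t].

Lemma same_prefix_fully_invariant n : 0 < n -> fully_invariant (same_prefix n).
Proof.
move=> n0; split.
- split=> [s|s t [->|[]]|s t u [->|[sn tn st]] [<-|[tn' un tu]]]; try by left.
  + by right.
  + by right.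
  + by right.
  + by right; rewrite st tu.
- move=> s s' t t' [<-|[sn s'n ss]] tt; last first.
    by right; rewrite !size_cat !takel_cat // ss !(leq_trans _ (leq_addr _ _)).
  case: tt => [<-|[tn t'n tt]]; [by left | right].
  rewrite !size_cat !(leq_trans _ (leq_addl _ _)) //; split=> //.
  rewrite !take_cat; case: ltnP => // _; congr cat.
  by rewrite -[LHS](@take_takel _ _ n) ?tt ?take_takel ?leq_subr.
- move=> f s t f0 [->|[sn tn st]]; [by left | right].
  have pre r : n <= size r -> take n (subst f r) = take n (subst f (take n r)).
    move=> rn; rewrite -[in LHS](cat_take_drop n r) subst_cat takel_cat //.
    by apply: leq_trans (size_subst _ f0); rewrite size_takel.
  by rewrite !(leq_trans _ (size_subst _ f0)) // pre // st -pre.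
- by move=> s [//|[]]; rewrite leqn0 => /eqP E; rewrite E in n0.
Qed.

(** Write p for x_1 ... x_n. Lower modularity is tested on Y, given by the
    identities of B between words longer than n, and Z, given by p = p z. Since
    p z = q z is an identity of Y, the chain p, p z, q z, q shows that
    p = q holds in the meet of Y and Z, hence in B \/ (Y /\ Z). By lower
    modularity, p = q follows from identities of Y and of B \/ Z. The former do
    not apply to p, which is too short; so some identity of B \/ Z takes p to a
    different word, which has p as a prefix because of Z. *)
Lemma lower_modular_absorption (B : SEM) n (q : seq nat) :
  lower_modular B -> eqn B (iota 0 n) q -> size q = n -> q <> iota 0 n ->
  exists s, s != [::] /\ eqn B (iota 0 n) (iota 0 n ++ s).
Proof.
move=> lmB pq qn qp; pose p := iota 0 n.
have n0 : 0 < n by case: n {pq p} qn qp => // /size0nil ->.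
have YP := fully_invariant_and (eqn_fully_invariant B)
  (long_identified_fully_invariant n).
pose Y := presented (fun s t => eqn B s t /\ long_identified n s t).
pose Z := presented (same_prefix n).
have eqnY s t := eqn_presented YP s t.
have eqnZ s t := eqn_presented (same_prefix_fully_invariant n0) s t.
have BY : (B <= Y)%O by apply/SEM_leP => s t /eqnY[].
have sp : size p = n by rewrite size_iota.
have : eqn (Order.join B (Order.meet Y Z)) p q.
  apply/eqn_join; split=> //; apply/eqn_meet.
  have extZ r : size r = n -> eqn Z r (r ++ [:: 0]).
    move=> rn; apply/eqnZ; right; rewrite size_cat rn takel_cat ?rn //.
    by rewrite leqnn leq_addr.
  apply: (rt_trans _ _ _ (p ++ [:: 0])); first by apply: rt_step; right; apply: extZ.
  apply: (rt_trans _ _ _ (q ++ [:: 0])); last by apply: rt_step; right; symmetry; apply: extZ.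
  apply: rt_step; left; apply/eqnY; split; first by rewrite /p pq.
  by right; rewrite !size_cat sp qn addn1.
(* The first step of the chain that leaves p provides s. *)
move=> /(eqn_anti (lmB _ Z BY))/eqn_meet pq'.
apply: contrapT => no_s; case: qp.
have := clos_rt_rtn1 _ _ _ _ pq'; elim=> [//|b c bc _ E].
rewrite {}E in bc; case: bc.
  by move/eqnY=> [_ [//|[]]]; rewrite sp ltnn.
move/eqn_join => [Bc /eqnZ [//|[_ nc]]]; rewrite take_oversize ?sp // => pc.
rewrite -(cat_take_drop n c) -pc in Bc *.
case E: (drop n c) Bc => [|x r] Bc; first by rewrite cats0.
by case: no_s; exists (x :: r).
Qed.

(** * Varieties in which the inner letters commute and words absorb *)

Lemma perm_pull (x : nat) k (c : seq nat) : k <= count_mem x c ->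
  exists c', perm_eq c (nseq k x ++ c').
Proof.
elim: k c => [|k IH] c kc; first by exists c.
have xc : x \in c by rewrite -has_pred1 has_count; lia.
have cE := seq.permP (perm_to_rem xc).
have [|c' c'E] := IH (rem x c); first by move: kc; rewrite (cE (pred1 x)) /= eqxx; lia.
by exists c'; rewrite (perm_trans (perm_to_rem xc)) //= perm_cons.
Qed.

Section MiddleCommutativity.
Variable D : SEM.
Hypothesis middle_comm : eqn D [:: 0; 1; 2; 3] [:: 0; 2; 1; 3].

Lemma eqn_swap h a b l : h != [::] -> l != [::] ->
  eqn D (h ++ a ++ b ++ l) (h ++ b ++ a ++ l).
Proof.
move=> h0 l0; have [->//|a0] := eqVneq a [::].
have [->//|b0] := eqVneq b [::].
pose f x := nth l [:: h; a; b] x.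
have f0 x : f x != [::] by case: x => [|[|[|x]]] //=; rewrite /f nth_default.
have := eqn_subst f0 middle_comm.
by rewrite /subst /= /f /= cats0.
Qed.

Lemma eqn_perm h l m m' : h != [::] -> l != [::] -> perm_eq m m' ->
  eqn D (h ++ m ++ l) (h ++ m' ++ l).
Proof.
move=> + l0; elim: m m' h => [|x m IH] m' h h0 mm'.
  by move: mm'; rewrite perm_sym => /perm_nilP ->.
have xm' : x \in m' by rewrite -(perm_mem mm') mem_head.
case/splitPr: xm' mm' => a b mm'.
have mab : perm_eq m (a ++ b).
  by apply/seq.permP => p; have := seq.permP mm' p; rewrite /= !count_cat /=; lia.
have := IH (a ++ b) (h ++ [:: x]) _ mab.
rewrite -!catA /= => ->; last by case: (h).
have := @eqn_swap h [:: x] a (b ++ l) h0; rewrite /=; apply.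
by case: (b).
Qed.

Section Absorption.
Variables (n : nat) (e : seq nat).
Hypothesis e0 : e != [::].
Hypothesis absorb : eqn D (iota 0 n) (iota 0 n ++ e).

Lemma n_gt0 : 0 < n.
Proof.
case: n absorb => // H; have := fi_nil (eqn_fully_invariant D) H.
by move/eqP; rewrite (negPf e0).
Qed.

(** The letters of the absorbed word that are foreign to x_1 ... x_n can be
    replaced by one of the latter. *)
Lemma absorb_inside : exists s, [/\ s != [::], all (gtn n) s &
  eqn D (iota 0 n) (iota 0 n ++ s)].
Proof.
pose f x := if x < n then x else 0.
exists (map f e); split; first by case: (e) e0.
  by apply/allP => _ /mapP[x _ ->] /=; rewrite /f; case: ifP => // _; apply: n_gt0.
have := @eqn_subst D (fun x => [:: f x]) _ _ (fun=> isT) absorb.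
rewrite !subst_map map_cat; suff -> : map f (iota 0 n) = iota 0 n by [].
by apply: map_id_in => x; rewrite mem_iota /f => /andP[_ ->].
Qed.

Let s := projT1 (cid absorb_inside).
Let r := size s.
Let s0 : s != [::]. Proof. by rewrite /s; case: cid => ? []. Qed.
Let s_lt : all (gtn n) s. Proof. by rewrite /s; case: cid => ? []. Qed.
Let s_absorb : eqn D (iota 0 n) (iota 0 n ++ s).
Proof. by rewrite /s; case: cid => ? []. Qed.

Let r_gt0 : 0 < r. Proof. by rewrite /r; case: (s) s0. Qed.

Lemma absorb_iter w k : size w = n ->
  eqn D w (w ++ flatten (nseq k [seq nth 0 w x | x <- s])).
Proof.
move=> wn; elim: k => [|k IH] /=; first by rewrite cats0.
rewrite catA.
have := @eqn_subst D (fun x => [:: nth 0 w x]) _ _ (fun=> isT) s_absorb.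
rewrite !subst_map map_cat map_nth_iota0 ?wn // take_oversize ?wn // => H.
by rewrite -H.
Qed.

(** As the inner letters commute, x can be moved to a position of an n-letter
    block w that occurs in s. Absorbing n copies of the image of s then creates
    n occurrences of x, and x^n = x^(n+r) is the same absorption applied to the
    word x^n. So r occurrences of x can be added, and the n copies removed. *)
Lemma absorb_letter h m l x : h != [::] -> l != [::] -> n <= size m -> x \in m ->
  eqn D (h ++ m ++ l) (h ++ (m ++ nseq r x) ++ l).
Proof.
move=> h0 l0 nm xm; pose j := head 0 s.
have jn : j < n by rewrite /j; case: (s) s0 s_lt => //= y t _ /andP[].
pose m' := rem x m.
have mm' : perm_eq m (take j m' ++ x :: drop j m').
  apply/seq.permP => p; rewrite (seq.permP (perm_to_rem xm) p) count_cat /=.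
  have -> : count p (rem x m) = count p (take j m') + count p (drop j m').
    by rewrite -count_cat cat_take_drop.
  by rewrite addnCA.
have jm' : j <= size m' by rewrite size_rem //; lia.
pose w := take n (take j m' ++ x :: drop j m').
pose b := drop n (take j m' ++ x :: drop j m').
have mwb : perm_eq m (w ++ b) by rewrite cat_take_drop.
have wn : size w = n by rewrite size_takel // -(perm_size mm').
have wj : nth 0 w j = x.
  by rewrite nth_take // nth_cat size_takel // ltnn subnn.
pose c := flatten (nseq n [seq nth 0 w x | x <- s]).
have xc : n <= count_mem x c.
  rewrite /c; elim: (n) => //= k IH; rewrite count_cat.
  suff H : 0 < count_mem x [seq nth 0 w x | x <- s] by rewrite -add1n leq_add.
  rewrite -has_count has_pred1; apply/mapP; exists j => //.
  by rewrite /j; case: (s) s0 => //= y t _; rewrite mem_head.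
have [c' /seq.permP cc'] := perm_pull xc.
have xx : eqn D (nseq n x) (nseq n x ++ nseq r x).
  have := @absorb_iter (nseq n x) 1 (size_nseq _ _).
  rewrite /= cats0; suff -> : [seq nth 0 (nseq n x) y | y <- s] = nseq r x by [].
  rewrite /r; elim: (s) s_lt => //= y t IH /andP[yn /IH ->].
  by rewrite nth_nseq yn.
have E1 a : eqn D (h ++ (m ++ a) ++ l) (h ++ (w ++ c ++ b ++ a) ++ l).
  have -> : eqn D (h ++ (m ++ a) ++ l) (h ++ (w ++ b ++ a) ++ l).
    by apply: eqn_perm; rewrite // catA perm_cat2r.
  by rewrite {1}(absorb_iter n wn) -!catA.
have -> : eqn D (h ++ m ++ l) (h ++ (nseq n x ++ c' ++ w ++ b) ++ l).
  rewrite -[X in h ++ X ++ l]cats0 E1; apply: eqn_perm => //.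
  by apply/seq.permP => p; have := cc' p; rewrite !count_cat /=; lia.
rewrite E1 {1}xx -!catA; symmetry.
have : eqn D (h ++ (w ++ c ++ b ++ nseq r x) ++ l)
    (h ++ (nseq n x ++ nseq r x ++ c' ++ w ++ b) ++ l).
  apply: eqn_perm => //; apply/seq.permP => p; rewrite !count_cat (cc' p) count_cat.
  move: (count p w) (count p b) (count p c') (count p (nseq n x)) => *.
  by move: (count p (nseq r x)) => *; lia.
by rewrite -!catA.
Qed.

Lemma middle_absorption : exists r', 0 < r' /\
  forall h m l x, h != [::] -> l != [::] -> n <= size m -> x \in m ->
  eqn D (h ++ m ++ l) (h ++ (m ++ nseq r' x) ++ l).
Proof. by exists r; split=> // *; apply: absorb_letter. Qed.

End Absorption.

End MiddleCommutativity.

(** * A bound on the identities to be considered *)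

Lemma size_le_counts K r m : all (gtn K) m -> (forall x, count_mem x m <= r) ->
  size m <= K * r.
Proof.
elim: K m => [|K IH] m mK mr; first by case: m mK mr.
rewrite -(count_predC (pred1 K)) mulSn leq_add // -size_filter IH // => [|x].
  apply/allP => x; rewrite mem_filter /= => /andP[xK xm].
  by have := allP mK x xm; rewrite /= ltnS leq_eqVlt (negPf xK).
rewrite count_filter; apply: leq_trans (mr x).
by apply: sub_count => y /andP[].
Qed.

Section FinitelyManyIdentities.
Variables (D : SEM) (n r : nat).
Hypothesis r_gt0 : 0 < r.
Hypothesis mid_perm : forall h l m m', h != [::] -> l != [::] -> perm_eq m m' ->
  eqn D (h ++ m ++ l) (h ++ m' ++ l).
Hypothesis mid_absorb : forall h m l x, h != [::] -> l != [::] -> n <= size m ->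
  x \in m -> eqn D (h ++ m ++ l) (h ++ (m ++ nseq r x) ++ l).

Let pad (g : nat -> nat) (t : seq nat) := flatten [seq nseq (r * g x) x | x <- t].

Let count_pad g t x : uniq t -> count_mem x (pad g t) = (x \in t) * (r * g x).
Proof.
elim: t => //= y t IH /andP[yt tu]; rewrite /pad /= count_cat -/(pad _ _) IH //.
rewrite count_nseq /= in_cons eq_sym; case: eqP => [->|_] //=.
by rewrite (negPf yt) mul0n addn0.
Qed.

Let eqn_pad h m l g t : h != [::] -> l != [::] -> n <= size m -> {subset t <= m} ->
  eqn D (h ++ m ++ l) (h ++ (m ++ pad g t) ++ l).
Proof.
move=> h0 l0; elim: t m => [|x t IH] m nm tm; first by rewrite /pad /= cats0.
have xm : x \in m by apply: tm; rewrite mem_head.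
have -> : eqn D (h ++ m ++ l) (h ++ (m ++ nseq (r * g x) x) ++ l).
  elim: (g x) => [|k IHk]; first by rewrite muln0 cats0.
  rewrite mulnS nseqD IHk (mid_absorb h0 l0 _ (x := x)).
  - by apply: mid_perm => //; rewrite -catA perm_cat2l perm_catC.
  - by rewrite size_cat (leq_trans nm) // leq_addr.
  - by rewrite mem_cat xm.
rewrite /pad /= [m ++ _ ++ _]catA; apply: IH => [|y yt].
  by rewrite size_cat (leq_trans nm) // leq_addr.
by rewrite mem_cat tm // in_cons yt orbT.
Qed.

(** Two inner parts with the same letters and the same multiplicities modulo r
    become permutations of each other once r (m' / r) occurrences of each letter
    are added to the former and r (m / r) to the latter, where m and m' stand
    for the multiplicities of that letter. *)
Lemma eqn_counts h m m' l : h != [::] -> l != [::] -> n <= size m -> n <= size m' ->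
  (forall x, (x \in m) = (x \in m')) ->
  (forall x, count_mem x m = count_mem x m' %[mod r]) ->
  eqn D (h ++ m ++ l) (h ++ m' ++ l).
Proof.
move=> h0 l0 nm nm' mm' cmm'.
have sub (w : seq nat) : {subset undup w <= w} by move=> x; rewrite mem_undup.
rewrite (eqn_pad (fun x => count_mem x m' %/ r) h0 l0 nm (sub m)).
rewrite (eqn_pad (fun x => count_mem x m %/ r) h0 l0 nm' (sub m')).
apply: mid_perm => //; apply/allP => x _ /=; apply/eqP.
rewrite !count_cat !count_pad ?undup_uniq // !mem_undup -mm'.
have [xm|xm] := boolP (x \in m); last first.
  by rewrite (count_memPn xm) (count_memPn _) // -mm'.
rewrite !mul1n {1}(divn_eq (count_mem x m) r) {2}(divn_eq (count_mem x m') r) cmm'.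
by move: (count_mem x m %/ r) (count_mem x m' %/ r) (_ %% r) => a b c; lia.
Qed.

(** This is the substitution y2 := y1^r followed by y1 := y1 y2: it first
    eliminates a letter and then brings it back. *)
Definition split_letter (y1 y2 z : nat) :=
  if z == y1 then [:: y1; y2]
  else if z == y2 then flatten (nseq r [:: y1; y2]) else [:: z].

Lemma split_letter_neq0 y1 y2 z : split_letter y1 y2 z != [::].
Proof. by rewrite /split_letter; case: ifP => // _; case: ifP => //; case: r r_gt0. Qed.

Lemma count_split y1 y2 z m : y1 != y2 ->
  count_mem z (subst (split_letter y1 y2) m) =
  if (z == y1) || (z == y2) then count_mem y1 m + r * count_mem y2 m
  else count_mem z m.
Proof.
move=> y12; elim: m => [|x m IH] /=; first by rewrite muln0; case: ifP.
rewrite subst_cons count_cat IH /split_letter.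
have cnt k : count_mem z (flatten (nseq k [:: y1; y2])) = k * ((y1 == z) + (y2 == z)).
  by elim: k => //= k ->; lia.
have [->|xy1] := eqVneq x y1; rewrite /= ?cnt.
  rewrite (negPf y12) [y1 == z]eq_sym [y2 == z]eq_sym.
  have [->|zy1] := eqVneq z y1; first by rewrite (negPf y12) /=; lia.
  by case: eqP => /=; lia.
have [->|xy2] := eqVneq x y2; rewrite /= ?cnt.
  rewrite [y1 == z]eq_sym [y2 == z]eq_sym.
  have [->|zy1] := eqVneq z y1; first by rewrite (negPf y12) /=; lia.
  by case: eqP => /=; lia.
by case: ifP => [/orP[/eqP->|/eqP->]|_]; rewrite ?(negPf xy1) ?(negPf xy2) ?addn0.
Qed.

(** The letters whose multiplicity alone does not describe their role in u:
    those of a short word, and the two end letters of a long one. *)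
Let anchors (u : seq nat) := if size u < n + 2 then u else [:: head 0 u; last 0 u].

(** Splitting adds to the multiplicity of y1 and of y2 the r-fold multiplicity
    of y2, up to the congruence modulo r between the two; so a word that does
    not distinguish y1 from y2 is preserved. *)
Lemma eqn_split y1 y2 u : y1 != y2 -> y1 \notin anchors u -> y2 \notin anchors u ->
  (y1 \in u) = (y2 \in u) -> count_mem y1 u = count_mem y2 u %[mod r] ->
  eqn D u (subst (split_letter y1 y2) u).
Proof.
move=> y12; rewrite /anchors; case: ltnP => [_|nu].
  move=> y1u y2u _ _; rewrite -[X in eqn _ X _]map_id -subst_map.
  rewrite (@eq_in_subst _ (split_letter y1 y2)) // => z zu; rewrite /split_letter.
  case: eqP => [E|_]; first by rewrite E (negPf y1u) in zu.
  by case: eqP => // E; rewrite E (negPf y2u) in zu.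
case: u nu => [|h t]; first by rewrite addn2.
case/lastP: t => [|m l]; first by rewrite addn2.
rewrite /= size_rcons last_rcons !inE !negb_or => nm /andP[y1h y1l] /andP[y2h y2l].
rewrite -cats1 !mem_cat !mem_seq1 !(eq_sym h) (negPf y1h) (negPf y2h) /=.
rewrite (negPf y1l) (negPf y2l) !orbF !count_cat /= !(eq_sym l) (negPf y1l) (negPf y2l).
rewrite !addn0 !add0n => y12m c12.
have fixp z : z != y1 -> z != y2 -> split_letter y1 y2 z = [:: z].
  by rewrite /split_letter => /negPf-> /negPf->.
rewrite subst_cons subst_cat fixp 1?eq_sym // [subst _ [:: l]]/subst /=.
rewrite fixp 1?eq_sym //=.
have nm' : n <= size m by lia.
apply: (@eqn_counts [:: h] _ _ [:: l]) => //.
- exact: leq_trans nm' (size_subst _ (split_letter_neq0 _ _)).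
- move=> x; rewrite -!has_pred1 !has_count count_split //.
  case: ifP => // /orP[/eqP->|/eqP->]; rewrite addn_gt0 muln_gt0 r_gt0 /=;
    rewrite -!has_count !has_pred1 y12m orbb //.
- move=> x; rewrite count_split //; case: ifP => // /orP[/eqP->|/eqP->].
    by rewrite addnC [r * _]mulnC modnMDl.
  by rewrite addnC [r * _]mulnC modnMDl c12.
Qed.

(** Each of the two sides of an identity has at most n + 2 anchors, and any
    other letter is described by its presence and its multiplicity modulo r in
    each side. *)
Let K := 2 * (n + 2) + (2 * r) * (2 * r).

Lemma two_similar_letters u v : K < size (undup (u ++ v)) -> exists y1 y2,
  [/\ y1 != y2, y1 \in u ++ v, y2 \in u ++ v &
     forall w, w \in [:: u; v] -> [/\ y1 \notin anchors w, y2 \notin anchors w,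
        (y1 \in w) = (y2 \in w) & count_mem y1 w = count_mem y2 w %[mod r]]].
Proof.
move=> KU; set U := undup (u ++ v) in KU.
pose G := [seq x <- U | x \notin anchors u ++ anchors v].
pose typ x : (bool * 'I_r) * (bool * 'I_r) :=
  ((x \in u, Ordinal (ltn_pmod (count_mem x u) r_gt0)),
   (x \in v, Ordinal (ltn_pmod (count_mem x v) r_gt0))).
have size_anchors w : size (anchors w) <= n + 2.
  by rewrite /anchors; case: ltnP => [/ltnW|]//= _; rewrite addn2.
have GU : (2 * r) * (2 * r) < size G.
  have : size [seq x <- U | x \in anchors u ++ anchors v] <= 2 * (n + 2).
    apply: (@leq_trans (size (anchors u ++ anchors v))).
      apply: uniq_leq_size; first by rewrite filter_uniq // undup_uniq.
      by move=> x; rewrite mem_filter => /andP[].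
    by rewrite size_cat mul2n -addnn leq_add.
  have -> : size G = size U - size [seq x <- U | x \in anchors u ++ anchors v].
    by rewrite !size_filter -(count_predC (mem (anchors u ++ anchors v))) addKn.
  rewrite /K in KU; lia.
have /existsNP[y1 /existsNP[y2 H]] : ~ {in G &, injective typ}.
  move=> inj; have Gu : uniq (map typ G).
    by rewrite map_inj_in_uniq // filter_uniq // undup_uniq.
  have := max_card [in map typ G]; rewrite (card_uniqP Gu) size_map.
  by rewrite !card_prod card_bool card_ord leqNgt GU.
move/not_implyP: H => [y1G /not_implyP[y2G /not_implyP[E y12]]].
rewrite !mem_filter !mem_undup ![_ \in anchors _ ++ _]mem_cat !negb_or in y1G y2G.
case/andP: y1G => /andP[au av] y1U; case/andP: y2G => /andP[bu bv] y2U.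
exists y1, y2; split=> //; first exact/eqP.
case: E => u12 cu v12 cv w; rewrite !inE => /orP[] /eqP->; split=> //.
Qed.

(** By induction on the number of letters. With more than K of them, two letters
    y1 and y2 play the same role in u and in v, so splitting preserves both
    words; but splitting factors through the instance u' = v' where y2 has been
    eliminated, and this instance holds by induction. With at most K letters,
    the identity is one of its own instances up to renaming. *)
Lemma reduce_letters u v :
  (forall f, (forall x, f x != [::]) -> (forall x, all (gtn K) (f x)) ->
     eqn D (subst f u) (subst f v)) ->
  eqn D u v.
Proof.
have few u' v' : size (undup (u' ++ v')) <= K ->
    (forall f, (forall x, f x != [::]) -> (forall x, all (gtn K) (f x)) ->
       eqn D (subst f u') (subst f v')) -> eqn D u' v'.
  set U := undup _ => UK H; pose f x := [:: if x \in U then index x U else 0].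
  have fK x : all (gtn K) (f x).
    rewrite /f /= andbT; case: ifP => [|_]; last by rewrite /K; lia.
    by rewrite -index_mem => xU; apply: leq_trans UK.
  pose g i := [:: nth 0 U i].
  have gf w : {subset w <= u' ++ v'} -> subst g (subst f w) = w.
    move=> wU; rewrite subst_comp -[RHS]map_id -[RHS]subst_map.
    apply: eq_in_subst => x /wU; rewrite -mem_undup => xU.
    by rewrite /f xU /subst /= /g nth_index.
  have := eqn_subst (f := g) (fun=> isT) (H f (fun=> isT) fK).
  by rewrite !gf // => x xw; rewrite mem_cat xw ?orbT.
move: {2}(size (undup (u ++ v))) (leqnn (size (undup (u ++ v)))) => N.
elim: N u v => [|N IH] u v UN Huv; first by apply: few => //; apply: leq_trans UN _.
have [/few|KU] := leqP (size (undup (u ++ v))) K; first exact.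
have [y1 [y2 [y12 y1U y2U sim]]] := two_similar_letters KU.
pose f z := if z == y2 then nseq r y1 else [:: z].
pose g z := if z == y1 then [:: y1; y2] else [:: z].
have f0 z : f z != [::] by rewrite /f; case: ifP => //; case: (r) r_gt0.
have g0 z : g z != [::] by rewrite /g; case: ifP.
have gf w : subst g (subst f w) = subst (split_letter y1 y2) w.
  rewrite subst_comp; apply: eq_in_subst => z _; rewrite /f /split_letter.
  have [->|zy2] := eqVneq z y2.
    by rewrite subst_nseq /g eqxx eq_sym (negPf y12).
  by rewrite /subst /= cats0 /g.
have [uA1 uA2 uI uC] := sim u (mem_head _ _).
have [|vA1 vA2 vI vC] := sim v _; first by rewrite !inE eqxx orbT.
rewrite (eqn_split y12 uA1 uA2 uI uC) (eqn_split y12 vA1 vA2 vI vC) -!gf.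
apply: eqn_subst => //; apply: IH => [|h h0 hK]; last first.
  rewrite !subst_comp; apply: Huv => x; first by rewrite subst_eq0.
  rewrite /f; case: ifP => _; last by rewrite /subst /= cats0.
  rewrite subst_nseq; apply/allP => y /flattenP[t /nseqP[-> _]].
  exact: (allP (hK y1)).
rewrite -ltnS; apply: leq_trans UN; rewrite -subst_cat.
rewrite [X in _ < X](perm_size (perm_to_rem (_ : y2 \in _))) ?mem_undup //= ltnS.
apply: uniq_leq_size; first exact: undup_uniq.
move=> x; rewrite mem_undup mem_rem_uniq ?undup_uniq // inE /= mem_undup.
move=> /flattenP[t /mapP[z zU ->]]; rewrite /f; case: eqP => [_|/eqP zy2].
  by move=> /nseqP[-> _]; rewrite y12 y1U.
by rewrite inE => /eqP->; rewrite zy2.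
Qed.

(** A long word over K letters has an inner letter with more than r
    occurrences, of which r can be erased. *)
Lemma reduce_length u : all (gtn K) u -> exists u',
  [/\ all (gtn K) u', size u' <= n + r + K * r + 2 & eqn D u u'].
Proof.
move: {2}(size u) (leqnn (size u)) => N.
elim: N u => [|N IH] u uN uK; first by exists u; rewrite (leq_trans uN).
have [us|us] := leqP (size u) (n + r + K * r + 2); first by exists u.
case: u us uN uK => // h t; case/lastP: t => [|m l]; first by rewrite /=; lia.
rewrite /= size_rcons all_rcons /= => us uN /and3P[hK lK mK].
have [x xr] : exists x, r < count_mem x m.
  apply: contrapT => H; have : size m <= K * r.
    by apply: size_le_counts => // x; rewrite leqNgt; apply/negP => xr; apply: H; exists x.
  lia.
have [c mc] := perm_pull xr.
have sc : size m = r.+1 + size c by rewrite (perm_size mc) size_cat size_nseq.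
have nc : n <= (size c).+1 by move: (K * r) us => kr us; lia.
have E : eqn D (h :: rcons m l) (h :: rcons (x :: c) l).
  transitivity ([:: h] ++ ((x :: c) ++ nseq r x) ++ [:: l]); rewrite -!cats1.
    apply: (@mid_perm [:: h] [:: l]) => //; apply: perm_trans mc _.
    by rewrite /= perm_cons perm_catC.
  symmetry; apply: (@mid_absorb [:: h] (x :: c) [:: l]); rewrite ?mem_head //.
have [||u' [u'K u's Eu']] := IH (h :: rcons (x :: c) l).
- by rewrite /= size_rcons /=; lia.
- have : all (gtn K) (nseq r.+1 x ++ c) by rewrite -(perm_all _ mc).
  by rewrite all_cat /= all_rcons /= hK lK => /andP[/andP[-> _] ->].
by exists u'; split=> //; rewrite E.
Qed.

Fixpoint short_words k L : seq (seq nat) :=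
  if L is L'.+1 then
    [::] :: [seq x :: w | x <- iota 0 k, w <- short_words k L']
  else [:: [::]].

Lemma mem_short_words k L w : all (gtn k) w -> size w <= L -> w \in short_words k L.
Proof.
elim: L w => [|L IH] [|x w] //= /andP[xk wk] wL; rewrite in_cons /=.
apply/allpairsP; exists (x, w); split=> //=; last exact: IH.
by rewrite mem_iota.
Qed.

Definition identity_variety (p : seq nat * seq nat) : SEM :=
  @Variety (models [set i | i.1.1 :: i.1.2 = p.1 /\ i.2.1 :: i.2.2 = p.2])
    (ex_intro _ _ erefl).

(** An identity of W < D that fails in D has, by [reduce_letters] and
    [reduce_length], a consequence that fails in D and that belongs to a finite
    list of identities which does not depend on W. *)
Lemma finite_identities_lower_cover : ~ no_lower_cover D.
Proof.
pose L := n + r + K * r + 2.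
pose T := [seq (a, b) | a <- short_words K L, b <- short_words K L].
apply: (@finitely_dominated_lower_cover D
  [seq Order.meet D (identity_variety p) | p <- T]).
move=> W /SEM_ltP[WD [u [v [Wuv Duv]]]].
have /existsNP[f H] := contra_not (@reduce_letters u v) Duv.
have {H}[f0 [fK Dfuv]] : (forall x, f x != [::]) /\ (forall x, all (gtn K) (f x)) /\
    ~ eqn D (subst f u) (subst f v).
  by apply: contrapT => N; apply: H => f0 fK; apply: contrapT => M; apply: N.
have sK w : all (gtn K) (subst f w).
  by apply/allP => y /flattenP[_ /mapP[x _ ->]]; apply: (allP (fK x)).
have [a [aK aL Da]] := reduce_length (sK u).
have [b [bK bL Db]] := reduce_length (sK v).
have Wab : eqn W a b.
  by rewrite -(eqn_anti WD Da) -(eqn_anti WD Db); apply: eqn_subst.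
have Dab : ~ eqn D a b by rewrite -Da -Db.
exists (Order.meet D (identity_variety (a, b))); split.
- apply: map_f; apply/allpairsP; exists (a, b); split=> //=; exact: mem_short_words.
- rewrite lexI WD; apply/asboolP => S WS i /= [ia ib].
  by apply: (proj1 (eqnE W i)) => //; rewrite ia ib.
apply/SEM_ltP; split; first exact: leIl.
exists a, b; split=> //; apply: eqn_anti (leIr _ _) _.
case: a b Wab Dab {aK aL Da bK bL Db} => [|x s] [|y t] Wab Dab.
- by case: Dab; reflexivity.
- by case: Wab.
- by case: Wab.
by apply/(@eqnE _ ((x, s), (y, t))) => S; apply.
Qed.

End FinitelyManyIdentities.

(** * The atoms of the lattice and their join *)

Definition bottom (W : SEM) : Prop := forall X, (W <= X)%O.

Definition atom (E : SEM) : Prop :=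
  ~ bottom E /\ forall W, (W <= E)%O -> W = E \/ bottom W.

Lemma bottomP W : bottom W <-> eqn W [:: 0] [:: 1].
Proof.
split=> [/(_ (presented (fun s t => (s == [::]) = (t == [::]))))|W01 X].
  move/eqn_anti; apply; apply/eqn_presented => //; split=> //.
  - by split=> // s t u ->.
  - move=> s s' t t'; rewrite -!size_eq0 !size_cat !addn_eq0 !size_eq0 => -> -> //.
  - by move=> f s t f0; rewrite !subst_eq0.
  - by move=> s /esym/eqP.
apply/SEM_leP => s t [e _]; have [s0|s0] := eqVneq s [::].
  by move: e; rewrite s0 eqxx => /esym/eqP->.
have t0 : t != [::] by rewrite -e.
have /= := eqn_subst (f := fun z => if z == 0 then s else t) _ W01.
by rewrite /subst /= !cats0; apply=> x; case: ifP.
Qed.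

(** The identities of the null semigroups, the semilattices, the left zero
    semigroups, the right zero semigroups and the abelian groups of exponent p
    are, in this order, the following five relations. *)
Definition null_relation := long_identified 1.
Definition content_relation (s t : seq nat) := s =i t.
Definition head_relation (s t : seq nat) := ohead s = ohead t.
Definition last_relation (s t : seq nat) := head_relation (rev s) (rev t).
Definition count_relation p (s t : seq nat) :=
  (s == [::]) = (t == [::]) /\ forall x, count_mem x s = count_mem x t %[mod p].

Lemma subst_mem f s x : (x \in subst f s) = has (fun z => x \in f z) s.
Proof. by elim: s => //= z s IH; rewrite subst_cons mem_cat IH. Qed.

Lemma content_fully_invariant : fully_invariant content_relation.
Proof.
split.
- by split=> [s x|s t st x|s t u st tu x]; rewrite ?st ?tu.
- by move=> s s' t t' ss tt x; rewrite !mem_cat ss tt.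
- by move=> f s t f0 st x; rewrite !subst_mem; apply: eq_has_r.
- by move=> [|x s] // /(_ x); rewrite mem_head.
Qed.

Lemma head_fully_invariant : fully_invariant head_relation.
Proof.
split.
- by split=> [s|s t|s t u] //; rewrite /head_relation => -> //.
- by move=> [|x s] [|y s'] t t' // [->].
- move=> f [|x s] [|y t] // f0 [->]; rewrite !subst_cons.
  by case: (f y) (f0 y).
- by move=> [].
Qed.

Lemma rev_subst f s : rev (subst f s) = subst (fun x => rev (f x)) (rev s).
Proof.
elim: s => //= x s IH.
by rewrite subst_cons rev_cat rev_cons -cats1 subst_cat -IH /subst /= cats0.
Qed.

Lemma rev_fully_invariant (R : seq nat -> seq nat -> Prop) : fully_invariant R ->
  fully_invariant (fun s t => R (rev s) (rev t)).
Proof.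
case=> [[re sy tr] ct sb nl]; split.
- by split=> [s|s t|s t u]; [apply: re | apply: sy | apply: tr].
- by move=> s s' t t' ss tt; rewrite !rev_cat; apply: ct.
- move=> f s t f0 st; rewrite !rev_subst; apply: sb => // x.
  by rewrite -size_eq0 size_rev size_eq0.
- by move=> s /nl /(congr1 size); rewrite size_rev => /size0nil.
Qed.

Lemma last_fully_invariant : fully_invariant last_relation.
Proof. exact: rev_fully_invariant head_fully_invariant. Qed.

(** An explicit set of summation U lets two words be compared term by term. *)
Lemma count_subst f s x (U : seq nat) : uniq U -> {subset s <= U} ->
  count_mem x (subst f s) = \sum_(y <- U) count_mem y s * count_mem x (f y).
Proof.
move=> Uu; elim: s => [_|z s IH sU]; first by rewrite big1_seq.
rewrite subst_cons count_cat IH => [|y ys]; last by apply: sU; rewrite in_cons ys orbT.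
under [RHS]eq_bigr do rewrite /= mulnDl.
rewrite big_split /=; congr addn.
rewrite (bigD1_seq z) ?sU ?mem_head //= eqxx mul1n big1_seq ?addn0 // => y /andP[yz _].
by rewrite eq_sym (negPf yz).
Qed.

Lemma count_fully_invariant p : fully_invariant (count_relation p).
Proof.
split.
- split=> [s|s t [e E]|s t u [e E] [e' E']]; first by split.
  + by split=> [|x]; rewrite ?e ?E.
  + by split=> [|x]; [rewrite e | rewrite E].
- move=> s s' t t' [e E] [e' E']; split.
    by rewrite -!size_eq0 !size_cat !addn_eq0 !size_eq0 e e'.
  by move=> x; rewrite !count_cat -modnDm E E' modnDm.
- move=> f s t f0 [e E]; split=> [|x]; first by rewrite !subst_eq0.
  have Uu := undup_uniq (s ++ t).
  rewrite !(count_subst _ _ Uu); last first.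
  + by move=> y ys; rewrite mem_undup mem_cat ys.
  + by move=> y yt; rewrite mem_undup mem_cat yt orbT.
  apply: (big_ind2 (fun a b => a = b %[mod p])) => // [a b a' b' ab ab'|y _].
    by rewrite -modnDm ab ab' modnDm.
  by rewrite -modnMml E modnMml.
- by move=> s [/esym/eqP].
Qed.

Section Nontrivial.
Variable V : SEM.

Let period k := eqn V [:: 0] (nseq k.+1 0).

Let periodD k l : period k -> period l -> period (k + l).
Proof.
move=> Pk Pl; rewrite /period -addSn nseqD.
transitivity ([:: 0] ++ nseq l 0); first exact: Pl.
by apply: eqn_cat; [exact: Pk | reflexivity].
Qed.

Let periodB k l : period (k + l) -> period k -> period l.
Proof.
move=> Pkl Pk; rewrite /period; transitivity (nseq (k + l).+1 0); first exact: Pkl.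
rewrite -addSn nseqD; symmetry.
by apply: (@eqn_cat V [:: 0]); [exact: Pk | reflexivity].
Qed.

Let periodM k j : period k -> period (j * k).
Proof.
move=> Pk; elim: j => [|j IH]; first by rewrite /period; reflexivity.
by rewrite mulSn; apply: periodD.
Qed.

Let period_gcd k l : 0 < k -> period k -> period l -> period (gcdn k l).
Proof.
move=> k0 Pk Pl; have [a _ /dvdnP[b E]] := Bezoutl l k0.
by apply: (@periodB (a * l)); [rewrite addnC E|]; apply: periodM.
Qed.

(** If y^r acts as a unit, substituting 0^r for all the letters but x leaves
    the multiplicity of x, modulo r. *)
Lemma collapse_count x r s : exists k,
  subst (fun z => if z == x then [:: 0] else nseq r 0) s =
    nseq (count_mem x s + r * k) 0.
Proof.
elim: s => [|z s [k IH]]; first by exists 0; rewrite muln0.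
rewrite subst_cons IH /=; case: eqP => _; first by exists k.
by exists k.+1; rewrite -nseqD; congr nseq; lia.
Qed.

(** Descent on the period r. If a prime p divides r, the abelian groups of
    exponent p are not all in V, so V satisfies an identity in which some letter
    has multiplicities a and b that differ modulo p. It yields the period b - a,
    and then the period gcd(r, b - a), which is smaller than r because p divides
    r but not b - a. *)
Lemma idempotent_of_no_prime_atom r : 0 < r -> period r ->
  (forall p, prime p -> ~ (presented (count_relation p) <= V)%O) -> period 1.
Proof.
move=> + + noA; elim/ltn_ind: r => r IH r0 Pr.
have [E|r1] := eqVneq r 1; first by rewrite -E.
have [p_pr p_r] : prime (pdiv r) /\ pdiv r %| r by rewrite pdiv_prime ?pdiv_dvd //; lia.
have /not_SEM_le[s [t [Vst]]] := noA _ p_pr.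
rewrite eqn_presented; last exact: count_fully_invariant.
move=> /not_andP[[]|]; first by case: Vst.
move=> /existsNP[x nst].
wlog st : s t Vst nst / count_mem x s < count_mem x t.
  move=> H; case: (ltngtP (count_mem x s) (count_mem x t)) => [st|ts|E].
  - exact: (H s t).
  - by apply: (H t s) => //; [symmetry | apply: nesym].
  - by case: nst; rewrite E.
pose f z := if z == x then [:: 0] else nseq r 0.
have f0 z : f z != [::] by rewrite /f; case: ifP => //; case: (r) r0.
have := eqn_subst f0 Vst.
have [i ->] := collapse_count x r s; have [j ->] := collapse_count x r t => Vij.
pose a := count_mem x s; pose b := count_mem x t.
have Pab : period (b - a).
  apply: (@periodB (r * (a + j))); last by rewrite mulnC; apply: periodM.
  (* Completing a + r i occurrences to 1 modulo r makes it possible to cancel. *)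
  have E1 : 1 + r * (a + i) = a + r * i + (1 + r * a - a) by nia.
  have E2 : (r * (a + j) + (b - a)).+1 = b + r * j + (1 + r * a - a).
    by rewrite /a /b; nia.
  have P1 : period (r * (a + i)) by rewrite mulnC; apply: periodM.
  rewrite /period; transitivity (nseq (r * (a + i)).+1 0); first exact: P1.
  rewrite E2 -add1n E1 nseqD [X in eqn _ _ X]nseqD.
  by apply: eqn_cat; [exact: Vij | reflexivity].
apply: (IH (gcdn r (b - a))).
- rewrite ltn_neqAle dvdn_leq ?dvdn_gcdl // andbT; apply/eqP => E.
  have rd : r %| b - a by rewrite -E dvdn_gcdr.
  apply: nst; apply/eqP; rewrite eq_sym eqn_mod_dvd ?(dvdn_trans p_r) //; exact: ltnW.
- by rewrite gcdn_gt0 r0.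
- exact: period_gcd.
Qed.

Hypothesis V_nontrivial : ~ bottom V.

Lemma has_period : ~ (presented null_relation <= V)%O -> exists2 r, 0 < r & period r.
Proof.
move=> /not_SEM_le[s [t [Vst]]].
rewrite eqn_presented; last exact: long_identified_fully_invariant.
move=> /not_orP[nst ns1].
wlog s1 : s t Vst nst ns1 / size s <= 1.
  move=> H; case: (leqP (size s) 1) => s1; first exact: (H s t).
  case: (leqP (size t) 1) => t1; last by case: ns1.
  by apply: (H t s); [symmetry | move=> E; apply: nst | move=> [? ?]; apply: ns1 |].
case: s s1 Vst nst {ns1} => [|x [|? ?]] // _ Vst nst.
  by have := fi_nil (eqn_fully_invariant V) Vst => E; rewrite E in nst.
have := eqn_subst (f := fun=> [:: 0]) (fun=> isT) Vst.
have -> : subst (fun=> [:: 0]) t = nseq (size t) 0.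
  by elim: (t) => //= y t' IH; rewrite subst_cons IH.
case: t Vst nst => [|y [|z t]] Vst nst E; [by case: E | | by exists (size t).+1].
case: V_nontrivial; apply/bottomP; have xy : x != y by apply: contra_notN nst => /eqP ->.
have := eqn_subst (f := fun z => [:: (z != x) : nat]) (fun=> isT) Vst.
by rewrite /subst /= eqxx eq_sym xy.
Qed.

Section Bands.
Hypothesis idem0 : eqn V [:: 0] [:: 0; 0].

Let idem a : eqn V (a ++ a) a.
Proof.
have [->|a0] := eqVneq a [::]; first by reflexivity.
have := eqn_subst (f := fun=> a) (fun=> a0) idem0.
by rewrite /subst /= !cats0 => H; symmetry.
Qed.

(** If z occurs in t only, sending z to 0 1 0 and the other letters to 0 turns
    s = t into 0 = 0 1 0, since an idempotent 0 satisfies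
    0 (0 1 0) = 0 1 0 = (0 1 0) (0 1 0) = (0 1 0) 0. *)
Lemma band_absorbs a b : ~ (presented content_relation <= V)%O -> a != [::] ->
  eqn V a (a ++ b ++ a).
Proof.
move=> /not_SEM_le[s [t [Vst]]].
rewrite eqn_presented; last exact: content_fully_invariant.
move=> /existsNP[z nst].
wlog [zs zt] : s t Vst nst / z \notin s /\ z \in t.
  move=> H; have [zs|zs] := boolP (z \in s); have [zt|zt] := boolP (z \in t).
  - by case: nst; rewrite zs zt.
  - by apply: (H t s); [symmetry | move=> E; apply: nst | split].
  - exact: (H s t).
  - by case: nst; rewrite (negPf zs) (negPf zt).
move=> a0; pose f x := if x == z then [:: 0; 1; 0] else [:: 0].
have f0 x : f x != [::] by rewrite /f; case: ifP.
have collapse w : eqn V (subst f w)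
    (if z \in w then [:: 0; 1; 0] else if w == [::] then [::] else [:: 0]).
  elim: w => [|x w IH]; first by reflexivity.
  have i1 l : eqn V (0 :: 0 :: l) (0 :: l).
    by apply: (@eqn_cat V [:: 0; 0] [:: 0]); [symmetry | reflexivity].
  have i2 : eqn V [:: 0; 1; 0; 0; 1; 0] [:: 0; 1; 0].
    transitivity [:: 0; 1; 0; 1; 0].
      by apply: (@eqn_cat V [:: 0; 1] [:: 0; 1]); [reflexivity | apply: i1].
    apply: (@eqn_cat V [:: 0; 1; 0; 1] [:: 0; 1]); last by reflexivity.
    exact: (@idem [:: 0; 1]).
  have i3 : eqn V [:: 0; 1; 0; 0] [:: 0; 1; 0].
    by apply: (@eqn_cat V [:: 0; 1] [:: 0; 1]); [reflexivity | apply: i1].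
  rewrite subst_cons IH in_cons /f [z == x]eq_sym; case: eqP => [_|_] /=.
    case: ifP => _; first exact: i2.
    by case: ifP => _; [reflexivity | exact: i3].
  by case: ifP => [_|zw]; [apply: i1 | case: ifP => _; [reflexivity | apply: i1]].
have := eqn_subst f0 Vst.
rewrite !collapse (negPf zs) zt; have -> : (s == [::]) = false.
  by case: Vst => + _; case: (t) zt => //= x t' _; case: (s).
move=> E; have [->|b0] := eqVneq b [::]; first by symmetry; apply: idem.
have := eqn_subst (f := fun x => if x == 0 then a else b) _ E.
by rewrite /subst /= !cats0; apply=> x; case: ifP.
Qed.

Hypothesis rect : forall a b, a != [::] -> eqn V a (a ++ b ++ a).

(** Collapsing an identity whose sides begin with different letters gives
    0 ... = 1 ...; multiplying it by 0 on the right turns its left side into 0,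
    by rectangularity, and the right side absorbs a further 1 on the left. *)
Lemma band_left_absorbs : ~ (presented head_relation <= V)%O -> eqn V [:: 0] [:: 1; 0].
Proof.
move=> /not_SEM_le[s [t [Vst]]].
rewrite eqn_presented; last exact: head_fully_invariant.
case: s t Vst => [|x s] [|y t] Vst nst; [by case: nst | by case: Vst | by case: Vst |].
have yx : y != x by apply/eqP => E; apply: nst; rewrite E.
pose f z := if z == x then [:: 0] else [:: 1].
have f0 z : f z != [::] by rewrite /f; case: ifP.
have := eqn_subst f0 Vst; rewrite !subst_cons /f eqxx (negPf yx) -/f => E.
have E0 : eqn V [:: 0] ([:: 1] ++ subst f t ++ [:: 0]).
  transitivity ([:: 0] ++ subst f s ++ [:: 0]); first exact: rect.
  by rewrite !catA E; reflexivity.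
transitivity ([:: 1] ++ subst f t ++ [:: 0]); first exact: E0.
transitivity ([:: 1; 1] ++ subst f t ++ [:: 0]).
  by apply: eqn_cat; [symmetry; apply: (@idem [:: 1]) | reflexivity].
by apply: (@eqn_cat V [:: 1] [:: 1]); [reflexivity | symmetry].
Qed.

Lemma band_right_absorbs : ~ (presented last_relation <= V)%O -> eqn V [:: 0] [:: 0; 1].
Proof.
move=> /not_SEM_le[s [t [Vst]]].
rewrite eqn_presented; last exact: last_fully_invariant.
case: (lastP s) (lastP t) Vst => [|{}s x] [|{}t y] Vst nst.
- by case: nst.
- by case: Vst; rewrite -!size_eq0 size_rcons.
- by case: Vst; rewrite -!size_eq0 size_rcons.
have yx : y != x.
  by apply/eqP => E; apply: nst; rewrite /last_relation /head_relation !rev_rcons E.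
pose f z := if z == x then [:: 0] else [:: 1].
have f0 z : f z != [::] by rewrite /f; case: ifP.
have := eqn_subst f0 Vst; rewrite -!cats1 !subst_cat.
rewrite [subst f [:: x]]/subst [subst f [:: y]]/subst /=.
rewrite /f eqxx (negPf yx) -/f /= => E.
have E0 : eqn V [:: 0] ([:: 0] ++ subst f t ++ [:: 1]).
  transitivity ([:: 0] ++ subst f s ++ [:: 0]); first exact: rect.
  by rewrite E; reflexivity.
transitivity ([:: 0] ++ subst f t ++ [:: 1]); first exact: E0.
transitivity (([:: 0] ++ subst f t ++ [:: 1]) ++ [:: 1]).
  rewrite -!catA; do 2!(apply: eqn_cat; first by reflexivity).
  by symmetry; apply: (@idem [:: 1]).
by apply: (@eqn_cat V _ [:: 0]); [symmetry | reflexivity].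
Qed.

End Bands.
End Nontrivial.

Definition atomic_relation (R : seq nat -> seq nat -> Prop) : Prop :=
  R = null_relation \/ R = content_relation \/ R = head_relation \/
  R = last_relation \/ exists2 p, prime p & R = count_relation p.

Lemma atomic_fully_invariant R : atomic_relation R -> fully_invariant R.
Proof.
move=> [->|[->|[->|[->|[p _ ->]]]]].
- exact: long_identified_fully_invariant.
- exact: content_fully_invariant.
- exact: head_fully_invariant.
- exact: last_fully_invariant.
- exact: count_fully_invariant.
Qed.

Lemma atomic_nontrivial R : atomic_relation R -> ~ bottom (presented R).
Proof.
move=> aR /bottomP; rewrite eqn_presented; last exact: atomic_fully_invariant.
case: aR => [->|[->|[->|[->|[p p_pr ->]]]]].
- by case=> [|[]].
- by move/(_ 0).
- by [].
- by [].
case=> _ /(_ 0) /=; rewrite mod0n modn_small ?prime_gt1 //.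
Qed.

Lemma atomic_middle_comm R : atomic_relation R ->
  eqn (presented R) [:: 0; 1; 2; 3] [:: 0; 2; 1; 3].
Proof.
move=> aR; rewrite eqn_presented; last exact: atomic_fully_invariant.
case: aR => [->|[->|[->|[->|[p p_pr ->]]]]].
- by right.
- by move=> x; rewrite !inE [(x == 1) || _]orbCA.
- by [].
- by [].
by split=> // x /=; rewrite [(1 == x) + _]addnCA.
Qed.

(** Excluding these varieties one after the other, V satisfies x = x^(r+1), then
    x = x^2, x = x y x, x = y x and x = x y; the last two give x = y. *)
Lemma nontrivial_contains_atomic V : ~ bottom V ->
  exists R, atomic_relation R /\ (presented R <= V)%O.
Proof.
move=> Vnt; apply: contrapT => noR.
have no R : atomic_relation R -> ~ (presented R <= V)%O.
  by move=> aR RV; apply: noR; exists R.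
have [r r0 Pr] := has_period Vnt (no _ (or_introl erefl)).
have P1 : eqn V [:: 0] [:: 0; 0].
  apply: (idempotent_of_no_prime_atom r0 Pr) => p p_pr; apply: no.
  by do 4!right; exists p.
have rect a b : a != [::] -> eqn V a (a ++ b ++ a).
  by apply: band_absorbs => //; apply: no; right; left.
have L := band_left_absorbs P1 rect (no _ (or_intror (or_intror (or_introl erefl)))).
have Rt := band_right_absorbs P1 rect
  (no _ (or_intror (or_intror (or_intror (or_introl erefl))))).
apply: Vnt; apply/bottomP; rewrite L; symmetry.
have := eqn_subst (f := fun x => [:: (x == 0) : nat]) (fun=> isT) Rt.
by rewrite /subst /=.
Qed.

Lemma atom_middle_comm E : atom E -> eqn E [:: 0; 1; 2; 3] [:: 0; 2; 1; 3].
Proof.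
move=> [Ent Emin]; have [R [aR RE]] := nontrivial_contains_atomic Ent.
by have [<-|/(atomic_nontrivial aR)] := Emin _ RE; first exact: atomic_middle_comm.
Qed.

(** A proper subvariety satisfies x^a = x^b for some a and b that differ modulo
    p, hence y = y x^d for some d prime to p, and then y = y x. *)
Lemma count_atom p : prime p -> atom (presented (count_relation p)).
Proof.
move=> p_pr; have aR : atomic_relation (count_relation p) by do 4!right; exists p.
split; first exact: atomic_nontrivial.
have eqnA s t := eqn_presented (count_fully_invariant p) s t.
move=> W WA; apply: contrapT => /not_orP[WnA Wnt].
have /not_SEM_le[s [t [Wst]]] : ~ (presented (count_relation p) <= W)%O.
  by move=> AW; apply: WnA; apply/eqP; rewrite eq_le WA.
rewrite eqnA => /not_andP[[]|/existsNP[x nst]]; first by case: Wst.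
have Ast u v : u != [::] -> v != [::] ->
    (forall y, count_mem y u = count_mem y v %[mod p]) -> eqn W u v.
  move=> /negPf u0 /negPf v0 uv; apply: eqn_anti WA _; apply/eqnA.
  by split=> //; rewrite u0 v0.
have p0 := prime_gt0 p_pr.
pose f z := if z == x then [:: 0] else nseq p 0.
have f0 z : f z != [::] by rewrite /f; case: ifP => //; case: (p) p0.
have := eqn_subst f0 Wst.
have [i ->] := collapse_count x p s; have [j ->] := collapse_count x p t => Wij.
pose a := count_mem x s + p * i; pose b := count_mem x t + p * j.
have ab : b <> a %[mod p].
  by rewrite /a /b ![p * _]mulnC ![_ + _ * p]addnC !modnMDl; apply: nesym.
pose d := b + a * p.-1.
have d0 : ~~ (p %| d).
  apply/negP => /dvdnP[q E]; apply: ab; rewrite -(modnMDl a b p).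
  have -> : a * p + b = q * p + a; last by rewrite modnMDl.
  by rewrite -E /d -[X in a * X](prednK p0) mulnS addnC addnA addnAC addnA.
have W1 : eqn W [:: 1] (1 :: nseq d 0).
  transitivity (1 :: nseq (a + a * p.-1) 0).
    apply: Ast => // y; rewrite /= !count_nseq /= -mulnS prednK //.
    by rewrite addn0 mulnA addnC modnMDl.
  rewrite [nseq (a + _) 0]nseqD [nseq d 0]nseqD.
  apply: (@eqn_cat W [:: 1] [:: 1]); first by reflexivity.
  by apply: eqn_cat; [exact: Wij | reflexivity].
have Wk k : eqn W [:: 1] (1 :: nseq (k * d) 0).
  elim: k => [|k IH]; first by reflexivity.
  rewrite mulSn nseqD; transitivity (1 :: nseq (k * d) 0); first exact: IH.
  by apply: (@eqn_cat W [:: 1] (1 :: nseq d 0)); [exact: W1 | reflexivity].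
have dp : coprime d p by rewrite coprime_sym prime_coprime.
have [k kd] : exists k, k * d = 1 %[mod p].
  have d_gt0 : 0 < d by case: (d) d0 => //; rewrite dvdn0.
  have [[k l] /= E] := coprimeP p d_gt0 dp; exists k.
  have -> : k * d = l * p + 1 by lia.
  by rewrite modnMDl.
apply: Wnt; apply/bottomP.
have W10 : eqn W [:: 1] [:: 1; 0].
  rewrite {1}(Wk k); apply: Ast => // y /=; rewrite count_nseq addn0 /=.
  by rewrite -modnDmr -modnMmr kd modnMmr modnDmr muln1.
have W01 : eqn W [:: 0] [:: 0; 1].
  have := eqn_subst (f := fun z => [:: (z == 0) : nat]) (fun=> isT) W10.
  by rewrite /subst /=.
transitivity [:: 0; 1]; first exact: W01.
transitivity [:: 1; 0]; last by symmetry.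
by apply: Ast => // y /=; rewrite addnCA.
Qed.

Definition atoms_join (A : SEM) : Prop :=
  (forall E, atom E -> (E <= A)%O) /\
  forall Y, (forall E, atom E -> (E <= Y)%O) -> (A <= Y)%O.

Lemma atoms_join_exists : exists A, atoms_join A.
Proof.
pose R s t := (s == [::]) = (t == [::]) /\ forall E, atom E -> eqn E s t.
have RP : fully_invariant R.
  split.
  - split=> [s|s t [e H]|s t u [e H] [e' H']].
    + by split=> // E _; reflexivity.
    + by split=> // E aE; symmetry; apply: H.
    + by split=> [|E aE]; [rewrite e | rewrite (H E aE) (H' E aE); reflexivity].
  - move=> s s' t t' [e H] [e' H']; split=> [|E aE].
      by rewrite -!size_eq0 !size_cat !addn_eq0 !size_eq0 e e'.
    by rewrite (H E aE) (H' E aE); reflexivity.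
  - move=> f s t f0 [e H]; split=> [|E aE]; first by rewrite !subst_eq0.
    by apply: eqn_subst => //; apply: H.
  - by move=> s [/esym/eqP].
exists (presented R); split=> [E aE|Y YE].
  by apply/SEM_leP => s t /(eqn_presented RP)[_]; apply.
apply/SEM_leP => s t Yst; apply/(eqn_presented RP); split; first by case: Yst.
by move=> E aE; apply: eqn_anti (YE E aE) Yst.
Qed.

Lemma atoms_join_middle_comm A : atoms_join A -> eqn A [:: 0; 1; 2; 3] [:: 0; 2; 1; 3].
Proof.
move=> [_ least]; pose Y := identity_variety ([:: 0; 1; 2; 3], [:: 0; 2; 1; 3]).
have AY : (A <= Y)%O.
  apply: least => E aE; apply/asboolP => S ES i /= [i1 i2].
  by apply: (proj1 (eqnE E i)) => //; rewrite i1 i2; apply: atom_middle_comm.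
apply: eqn_anti AY _.
by apply/(@eqnE _ ((0, [:: 1; 2; 3]), (0, [:: 2; 1; 3]))) => S; apply.
Qed.

(** Multiplicities that are congruent modulo a prime larger than both are equal. *)
Lemma atoms_join_balanced A s t : atoms_join A -> eqn A s t -> perm_eq s t.
Proof.
move=> [upper _] Ast; apply/allP => x _ /=; apply/eqP.
have [p p_big p_pr] := prime_above (count_mem x s + count_mem x t).
have := eqn_anti (upper _ (count_atom p_pr)) Ast.
rewrite eqn_presented; last exact: count_fully_invariant.
by case=> _ /(_ x); rewrite !modn_small //; lia.
Qed.

(** * The lattice-theoretic criterion *)

Lemma perm_identityE n (a : 'S_n.+1) :
  (perm_identity a).1.1 :: (perm_identity a).1.2 = iota 0 n.+1 /\
  (perm_identity a).2.1 :: (perm_identity a).2.2 = [seq val (a i) | i <- enum 'I_n.+1].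
Proof. by split; rewrite -?val_enum_ord enum_ordSl /= -map_comp. Qed.

Lemma linear_renaming V s t : uniq s -> perm_eq s t -> s <> t -> eqn V s t ->
  exists q, [/\ perm_eq q (iota 0 (size s)), q <> iota 0 (size s) &
                eqn V (iota 0 (size s)) q].
Proof.
move=> su st neq Vst; pose f x := index x s; exists (map f t).
have sE : map f s = iota 0 (size s).
  apply: (@eq_from_nth _ 0) => [|i]; rewrite size_map ?size_iota // => si.
  by rewrite (nth_map 0) // nth_iota // /f index_uniq.
split.
- by rewrite -sE perm_sym; apply: perm_map.
- rewrite -sE => E; apply: neq; symmetry; apply/eqP; move/eqP: E.
  have fK w : {subset w <= s} -> map (nth 0 s) (map f w) = w.
    by move=> ws; rewrite -map_comp map_id_in // => x /ws xs; rewrite /= nth_index.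
  move/eqP/(congr1 (map (nth 0 s))); rewrite !fK // => [->//|x].
  by rewrite (perm_mem st).
have := eqn_subst (f := fun x => [:: f x]) (fun=> isT) Vst.
by rewrite !subst_map sE.
Qed.

Lemma permutativeP V : permutative V <-> exists s t,
  [/\ uniq s, perm_eq s t, s <> t & eqn V s t].
Proof.
split=> [[_ [n [a [a1 ->]]] /eqnE]|[s [t [su st neq Vst]]]].
  have [-> ->] := perm_identityE a => Va.
  exists (iota 0 n.+1), [seq val (a i) | i <- enum 'I_n.+1]; split=> //.
  - exact: iota_uniq.
  - rewrite -val_enum_ord map_comp; apply: perm_map; apply: uniq_perm.
    + exact: enum_uniq.
    + by rewrite (map_inj_uniq (@perm_inj _ a)) enum_uniq.
    move=> i; rewrite mem_enum inE; symmetry; apply/mapP.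
    by exists ((a^-1)%g i); rewrite ?mem_enum ?permKV.
  move/esym=> E; case/negP: a1; apply/eqP/permP => i; rewrite perm1.
  apply: val_inj; have := congr1 (fun w => nth 0 w i) E.
  rewrite (nth_map ord0) ?size_enum_ord // nth_ord_enum => ->.
  by rewrite nth_iota.
have {st neq Vst}[q [tq qneq qV]] := linear_renaming su st neq Vst.
have qs := perm_size tq; rewrite size_iota in qs.
move: tq qneq qV qs; case: (size s) => [|n]; first by case: (q).
move=> tq qneq qV qs.
have q_lt i : i < n.+1 -> nth 0 q i < n.+1.
  move=> iq; have : nth 0 q i \in q by rewrite mem_nth ?qs.
  by rewrite (perm_mem tq) mem_iota.
pose g (i : 'I_n.+1) := Ordinal (q_lt i (ltn_ord i)).
have g_inj : injective g.
  move=> i j /(congr1 val) /= E; apply: val_inj => /=; apply/eqP.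
  rewrite -(nth_uniq 0 _ _ (s := q)) ?qs ?E //.
  by rewrite (perm_uniq tq) iota_uniq.
have [E1 E2] := perm_identityE (perm g_inj).
have gq : [seq val (perm g_inj i) | i <- enum 'I_n.+1] = q.
  rewrite -[RHS](mkseq_nth 0) qs /mkseq -val_enum_ord -map_comp.
  by apply: eq_map => i /=; rewrite permE.
exists (perm_identity (perm g_inj)); last by apply/eqnE; rewrite E1 E2 gq.
exists n, (perm g_inj); split=> //; apply/eqP => g1; apply: qneq.
rewrite -gq g1 -val_enum_ord; apply: eq_map => i.
by rewrite perm1.
Qed.

(** If V is not permutative, N and C serve as B and D; otherwise D would have to
    satisfy an absorption identity inherited from B, and so have a lower cover. *)
Lemma permutative_criterion V : permutative V <-> ~ exists A B D,
  [/\ atoms_join A, lower_modular B, no_lower_cover D &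
     [/\ (D <= B)%O, (D <= A)%O & (B <= Order.join V A)%O]].
Proof.
split=> [/permutativeP[s [t [su st neq Vst]]] [A [B [D [AP lmB nlcD [DB DA BVA]]]]]|H].
  have {st neq Vst}[q [qn qneq Vq]] := linear_renaming su st neq Vst.
  move: (size s) => n in qn qneq Vq.
  (* The end letters protect q from A, where only inner letters commute. *)
  pose q' := [:: 0] ++ map S q ++ [:: n.+1].
  have iotaE : iota 0 n.+2 = [:: 0] ++ map S (iota 0 n) ++ [:: n.+1].
    have E : iota 1 (n + 1) = iota 1 n ++ [:: n.+1] by rewrite iotaD add1n.
    by rewrite -(iotaDl 1) /= -E addn1.
  have WBq : eqn B (iota 0 n.+2) q'.
    rewrite iotaE; apply: eqn_anti BVA _; apply/eqn_join; split.
      have := eqn_subst (f := fun x => [:: S x]) (fun=> isT) Vq; rewrite !subst_map => E.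
      by rewrite E; reflexivity.
    rewrite perm_sym in qn; rewrite /q'.
    apply: (@eqn_perm A (atoms_join_middle_comm AP) [:: 0] [:: n.+1]) => //.
    exact: perm_map.
  have [||e [e0 Be]] := lower_modular_absorption lmB WBq.
  - by rewrite /q' !size_cat size_map (perm_size qn) size_iota /= addn1.
  - have sq : size q = n by rewrite (perm_size qn) size_iota.
    rewrite /q' iotaE => /(congr1 (fun w => map predn (take n (behead w)))) /=.
    by rewrite !take_size_cat ?size_map ?size_iota // -!map_comp !map_id.
  have Dmc := eqn_anti DA (atoms_join_middle_comm AP).
  have De := eqn_anti DB Be.
  have [r [r0 absorb]] := middle_absorption Dmc e0 De.
  apply: (finite_identities_lower_cover (n := n.+2) r0 _ absorb) nlcD => h l m m' h0 l0.
  exact: eqn_perm.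
apply: contrapT => Vnp; apply: H.
have [A AP] := atoms_join_exists.
exists A, linear_nil, comm_linear_nil; split=> //.
- exact: linear_nil_lower_modular.
- exact: comm_linear_nil_no_lower_cover.
split; first exact: comm_linear_nil_le.
  apply/SEM_leP => s t /(atoms_join_balanced AP) st; apply/eqn_comm_linear_nil; by left.
apply/SEM_leP => s t /eqn_join[Vst /(atoms_join_balanced AP) st].
apply/eqn_linear_nil; have [su|su] := boolP (uniq s); last first.
  by right; rewrite -(perm_uniq st).
left; apply: contrapT => neq; apply: Vnp; apply/permutativeP.
by exists s, t.
Qed.

(** * The formula *)

Section Formulas.
Variable n : nat.
Implicit Types (i : 'I_n) (s t : lterm n).

(** Under one more quantifier, [up i] denotes the variable that was [i]. *)
Definition up n (i : 'I_n) : 'I_n.+1 := lift ord0 i.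

Definition fle s t : lformula n := LEq (LMeet s t) s.
Definition flt s t : lformula n := LAnd (fle s t) (LNot (fle t s)).

End Formulas.

Definition fbottom n (i : 'I_n) : lformula n := LForall (fle (LVar (up i)) (LVar ord0)).

Definition fatom n (i : 'I_n) : lformula n :=
  LAnd (LNot (fbottom i))
    (LForall (LImp (fle (LVar ord0) (LVar (up i)))
       (LOr (LEq (LVar ord0) (LVar (up i))) (fbottom ord0)))).

Definition fatoms_join n (i : 'I_n) : lformula n :=
  LAnd (LForall (LImp (fatom ord0) (fle (LVar ord0) (LVar (up i)))))
    (LForall (LImp (LForall (LImp (fatom ord0) (fle (LVar ord0) (LVar (up ord0)))))
       (fle (LVar (up i)) (LVar ord0)))).

Definition flower_modular n (i : 'I_n) : lformula n :=
  let B := LVar (up (up i)) in let Y := LVar (up ord0) in let Z := LVar ord0 in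
  LForall (LForall (LImp (fle B Y)
    (fle (LMeet Y (LJoin B Z)) (LJoin B (LMeet Y Z))))).

Definition fno_lower_cover n (i : 'I_n) : lformula n :=
  LAnd (LExists (flt (LVar ord0) (LVar (up i))))
    (LForall (LImp (flt (LVar ord0) (LVar (up i)))
       (LExists (LAnd (flt (LVar (up ord0)) (LVar ord0))
                      (flt (LVar ord0) (LVar (up (up i)))))))).

#[local] Arguments scons : simpl never.
#[local] Arguments holds : simpl never.

Lemma scons0 n (x : SEM) (e : 'I_n -> SEM) : scons x e ord0 = x.
Proof. by rewrite /scons unlift_none. Qed.

Lemma scons_up n (x : SEM) (e : 'I_n -> SEM) i : scons x e (up i) = e i.
Proof. by rewrite /scons /up liftK. Qed.

Section HoldsEquations.
Variables (n : nat) (e : 'I_n -> SEM).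

Lemma holds_not f : holds (LNot f) e = ~ holds f e. Proof. by []. Qed.

Lemma holds_and f g : holds (LAnd f g) e = (holds f e /\ holds g e).
Proof. by []. Qed.

Lemma holds_or f g : holds (LOr f g) e = (holds f e \/ holds g e).
Proof. by []. Qed.

Lemma holds_imp f g : holds (LImp f g) e = (holds f e -> holds g e).
Proof. by []. Qed.

Lemma holds_eq s t : holds (LEq s t) e = (leval e s = leval e t).
Proof. by []. Qed.

Lemma holds_forall f : holds (LForall f) e = forall x, holds f (scons x e).
Proof. by []. Qed.

Lemma holds_exists f : holds (LExists f) e = exists x, holds f (scons x e).
Proof. by []. Qed.

Lemma holds_fle s t : holds (fle s t) e = (leval e s <= leval e t)%O.
Proof. by apply/propext; rewrite holds_eq /=; split=> /meet_idPl. Qed.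

Lemma holds_flt s t : holds (flt s t) e = (leval e s < leval e t)%O.
Proof.
rewrite holds_and holds_not !holds_fle lt_leAnge.
by apply/propext; split=> [[-> /negP]|/andP[-> /negP]].
Qed.

End HoldsEquations.

Lemma holds_fbottom n (e : 'I_n -> SEM) i : holds (fbottom i) e = bottom (e i).
Proof.
rewrite holds_forall; apply: eq_forall => X.
by rewrite holds_fle /= scons0 scons_up.
Qed.

Lemma holds_fatom n (e : 'I_n -> SEM) i : holds (fatom i) e = atom (e i).
Proof.
rewrite /fatom holds_and holds_not holds_fbottom holds_forall; congr (_ /\ _).
apply: eq_forall => W.
by rewrite holds_imp holds_fle holds_or holds_fbottom holds_eq /= scons0 scons_up.
Qed.

Lemma holds_fatoms_join n (e : 'I_n -> SEM) i :
  holds (fatoms_join i) e = atoms_join (e i).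
Proof.
rewrite /fatoms_join holds_and !holds_forall; congr (_ /\ _); apply: eq_forall => Y.
  by rewrite holds_imp holds_fatom holds_fle /= scons0 scons_up.
rewrite holds_imp holds_fle holds_forall /= scons0 scons_up; congr (_ -> _).
apply: eq_forall => E.
by rewrite holds_imp holds_fatom holds_fle /= scons_up !scons0.
Qed.

Lemma holds_flower_modular n (e : 'I_n -> SEM) i :
  holds (flower_modular i) e = lower_modular (e i).
Proof.
rewrite /flower_modular /= holds_forall; apply: eq_forall => Y.
rewrite holds_forall; apply/propext; split=> H.
  by move=> Z BY; have := H Z; rewrite holds_imp !holds_fle /= !scons_up !scons0; apply.
by move=> Z; rewrite holds_imp !holds_fle /= !scons_up !scons0; apply: H.
Qed.

Lemma holds_fno_lower_cover n (e : 'I_n -> SEM) i :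
  holds (fno_lower_cover i) e = no_lower_cover (e i).
Proof.
rewrite /fno_lower_cover holds_and holds_exists holds_forall; congr (_ /\ _).
  by apply: eq_exists => W; rewrite holds_flt /= scons0 scons_up.
apply: eq_forall => W.
rewrite holds_imp holds_flt holds_exists /= scons0 scons_up; congr (_ -> _).
by apply: eq_exists => U; rewrite holds_and !holds_flt /= !scons_up !scons0.
Qed.

Definition fnonpermutative : lformula 1 :=
  let A := LVar (up (up ord0)) in let B := LVar (up ord0) in let D := LVar ord0 in
  let V := LVar (up (up (up ord0))) in
  LExists (LExists (LExists
    (LAnd (LAnd (fatoms_join (up (up ord0)))
             (LAnd (flower_modular (up ord0)) (fno_lower_cover ord0)))
       (LAnd (fle D B) (LAnd (fle D A) (fle B (LJoin V A))))))).

Lemma holds_fnonpermutative (e : 'I_1 -> SEM) : holds fnonpermutative e = exists A B D,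
  [/\ atoms_join A, lower_modular B, no_lower_cover D &
     [/\ (D <= B)%O, (D <= A)%O & (B <= Order.join (e ord0) A)%O]].
Proof.
rewrite /fnonpermutative /= holds_exists; apply: eq_exists => A.
rewrite holds_exists; apply: eq_exists => B.
rewrite holds_exists; apply: eq_exists => D.
rewrite holds_and holds_and holds_fatoms_join holds_and holds_flower_modular.
rewrite holds_fno_lower_cover !holds_and !holds_fle /= !scons_up !scons0.
by apply/propext; split=> [[[? [? ?]] [? [? ?]]]|[? ? ? []]].
Qed.

Theorem theorem6p1 : definable [set V : SEM | permutative V].
Proof.
exists (LNot fnonpermutative) => V.
by rewrite holds_not holds_fnonpermutative [X in _ <-> X]permutative_criterion.
Qed.
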